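(* Let $f\in\mathbb{Z}[\mathbb{H}]$ be of the form $f=g_1(y,z)x-g_0(y,z)$ with $g_0,g_1\in\mathbb{Z}[y,z]\simeq\mathbb{Z}[\mathbb{Z}^2]$. Suppose there exists an element $\chi\in\mathbb{S}$ of infinite order which satisfies either of the following conditions: (i) $\mathsf{U}_\chi(g_0)=\varnothing$, $\mathsf{U}_\chi(g_1)\neq\varnothing$ and $\int\phi_\chi\,d\lambda_{\mathbb{S}}<0$; (ii) $\mathsf{U}_\chi(g_0)\neq\varnothing$, $\mathsf{U}_\chi(g_1)=\varnothing$ and $\int\phi_\chi\,d\lambda_{\mathbb{S}}>0$. Then the principal algebraic action $\alpha_f$ on $X_f$ is non-expansive (i.e. not expansive).
   Context: $\mathbb{S}=\{\zeta\in\mathbb{C}:|\zeta|=1\}$, with normalised Lebesgue (Haar) measure $\lambda_{\mathbb{S}}$. $\mathbb{H}$ is the discrete Heisenberg group of upper triangular unipotent $3\times3$ integer matrices, generated by $x=\begin{pmatrix}1&1&0\\0&1&0\\0&0&1\end{pmatrix}$, $y=\begin{pmatrix}1&0&0\\0&1&1\\0&0&1\end{pmatrix}$, with central element $z=xyx^{-1}y^{-1}$. $\mathbb{Z}[\mathbb{H}]$ is the integer group ring; $\mathbb{Z}[y,z]\simeq\mathbb{Z}[\mathbb{Z}^2]$ means integer Laurent polynomials in the commuting elements $y,z$. For $\chi\in\mathbb{S}$ and $i=0,1$: $\mathsf{U}_\chi(g_i)=\{\zeta\in\mathbb{S}: g_i(\zeta,\chi)=0\}$, and $$\psi_\chi(\zeta)=\frac{g_0(\zeta,\chi)}{g_1(\zeta\chi^{-1},\chi)},\qquad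 \phi_\chi(\zeta)=\log|\psi_\chi(\zeta)|\qquad(\zeta\in\mathbb{S})$$ (the conditions on $\int\phi_\chi\,d\lambda_{\mathbb{S}}$ presuppose that the denominator is not identically zero in $\zeta$; $\log 0=-\infty$). Let $\mathbb{T}=\mathbb{R}/\mathbb{Z}$. For $f=\sum_\gamma f_\gamma\cdot\gamma\in\mathbb{Z}[\mathbb{H}]$, $X_f=\{v\in\mathbb{T}^{\mathbb{H}}:\sum_{\gamma\in\mathbb{H}}f_\gamma v_{\gamma'\gamma}=0\text{ for every }\gamma'\in\mathbb{H}\}$ and $\alpha_f$ is the restriction to $X_f$ of the left shift action $(\lambda^\gamma v)_{\gamma'}=v_{\gamma^{-1}\gamma'}$. An action $\alpha$ of a countable group $\Gamma$ by automorphisms of a compact metrisable abelian group $X$, with translation invariant (compatible) metric $d$, is expansive if there is $\varepsilon>0$ with $\sup_{\gamma\in\Gamma}d(\alpha^\gamma v,\alpha^\gamma w)>\varepsilon$ for all distinct $v,w\in X$. *)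

(* Defs.v *)
From HB Require Import structures.
From mathcomp Require Import all_boot all_order all_algebra finmap.
From mathcomp Require Import generic_quotient ring_quotient.
From mathcomp Require Import all_classical all_reals all_analysis.
From mathcomp Require Import complex.
From mathcomp Require Import ring.
(* The notations of the multinomials library clash with those of
   MathComp-Analysis. *)
From mathcomp Require multinomials.monalg.
Import (canonicals) multinomials.monalg.

Set Implicit Arguments.
Unset Strict Implicit.
Unset Printing Implicit Defensive.

Import Order.TTheory GRing.Theory Num.Theory.
Import numFieldNormedType.Exports.

Local Open Scope classical_set_scope.
Local Open Scope ring_scope.

(******************************************************************************)
(*          group_ring G == the integral group ring Z[G] of a group G         *)
(*             gcoef a u == the coefficient of a in u                         *)
(*             gmono a c == the element c a of the group ring                 *)
(*                  heis == the discrete Heisenberg group                     *)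
(*                    gx == x in Z[heis]                                      *)
(*            hx, hy, hz == its generators x, y and z = x y x^-1 y^-1         *)
(*               laurent == integer Laurent polynomials in two variables      *)
(*            lpoly_yz g == g(y, z) in Z[heis]                                *)
(*      lpoly_eval g a b == g(a, b)                                           *)
(*               torus R == R / Z                                             *)
(*       shift_space R G == (R / Z)^G with the product topology               *)
(*   principal_group R u == the compact abelian group X_u                     *)
(*  principal_action R u == the action alpha_u of G on X_u                    *)
(******************************************************************************)

Notation gcoef := (@monalg.mcoeff _ int).
Notation gsupp := (@monalg.msupp _ int).
Notation gmono := (@monalg.mkmalgU _ int).

Definition group_ring (G : groupType) : Type := monalg.malg G int.

HB.instance Definition _ (G : groupType) :=
  GRing.Zmodule.copy (group_ring G) (monalg.malg G int).

Section GroupRing.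
Variable G : groupType.
Implicit Types (u v w : group_ring G) (a b : G).

Definition gr_one : group_ring G := gmono 1%g 1.

Definition gr_mul u v : group_ring G :=
  \sum_(a <- gsupp u) \sum_(b <- gsupp v)
    gmono (a * b)%g (gcoef a u * gcoef b v).

Lemma gr_mulw (d1 d2 : {fset G}) u v : (gsupp u `<=` d1)%fset -> (gsupp v `<=` d2)%fset ->
  gr_mul u v = \sum_(a <- d1) \sum_(b <- d2)
                 gmono (a * b)%g (gcoef a u * gcoef b v).
Proof.
move=> le1 le2; rewrite /gr_mul (big_fset_incl _ le1) /=.
  apply: eq_bigr => a _; apply: big_fset_incl => // b _ /monalg.mcoeff_outdom ->.
  by rewrite mulr0 monalg.monalgU0.
move=> a _ /monalg.mcoeff_outdom ua.
by rewrite big1 // => b _; rewrite ua mul0r monalg.monalgU0.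
Qed.

Lemma gr_mul0l : left_zero 0 gr_mul.
Proof. by move=> v; rewrite /gr_mul monalg.msupp0 big_seq_fset0. Qed.

Lemma gr_mul0r : right_zero 0 gr_mul.
Proof.
by move=> u; rewrite /gr_mul big1 // => a _; rewrite monalg.msupp0 big_seq_fset0.
Qed.

Lemma gr_mulDl : left_distributive gr_mul +%R.
Proof.
move=> u v w; pose d : {fset G} := (gsupp u `|` gsupp v)%fset.
rewrite (@gr_mulw d (gsupp w) u) ?fsubsetUl// (@gr_mulw d (gsupp w) v) ?fsubsetUr//.
rewrite (@gr_mulw d (gsupp w) (u + v)) ?monalg.msuppD_le//.
rewrite -big_split; apply: eq_bigr => a _ /=.
rewrite -big_split; apply: eq_bigr => b _ /=.
by rewrite monalg.mcoeffD mulrDl monalg.monalgUD.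
Qed.

Lemma gr_mulDr : right_distributive gr_mul +%R.
Proof.
move=> w u v; pose d : {fset G} := (gsupp u `|` gsupp v)%fset.
rewrite (@gr_mulw (gsupp w) d w u) ?fsubsetUl// (@gr_mulw (gsupp w) d w v) ?fsubsetUr//.
rewrite (@gr_mulw (gsupp w) d w (u + v)) ?monalg.msuppD_le//.
rewrite -big_split; apply: eq_bigr => a _ /=.
rewrite -big_split; apply: eq_bigr => b _ /=.
by rewrite monalg.mcoeffD mulrDr monalg.monalgUD.
Qed.

Lemma gr_mulUU a b (c d : int) :
  gr_mul (gmono a c) (gmono b d) = gmono (a * b)%g (c * d).
Proof.
rewrite (gr_mulw monalg.msuppU_le monalg.msuppU_le) !big_seq_fset1.
by rewrite !monalg.mcoeffUU.
Qed.

Lemma gr_mulEl u v :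
  gr_mul u v = \sum_(a <- gsupp u) gr_mul (gmono a (gcoef a u)) v.
Proof.
by rewrite -(big_morph (gr_mul^~ _) (fun _ _ => gr_mulDl _ _ _) (gr_mul0l _))
  -monalg.monalgE.
Qed.

Lemma gr_mulEr u v :
  gr_mul u v = \sum_(b <- gsupp v) gr_mul u (gmono b (gcoef b v)).
Proof.
by rewrite -(big_morph (gr_mul _) (fun _ _ => gr_mulDr _ _ _) (gr_mul0r _))
  -monalg.monalgE.
Qed.

Lemma gr_mul1l : left_id gr_one gr_mul.
Proof.
move=> u; rewrite gr_mulEr [RHS]monalg.monalgE.
by apply: eq_bigr => a _; rewrite gr_mulUU mul1r mul1g.
Qed.

Lemma gr_mul1r : right_id gr_one gr_mul.
Proof.
move=> u; rewrite gr_mulEl [RHS]monalg.monalgE.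
by apply: eq_bigr => a _; rewrite gr_mulUU mulr1 mulg1.
Qed.

Lemma gr_mulA : associative gr_mul.
Proof.
have suml w (r : {fset G}) F : gr_mul (\sum_(a <- r) F a) w =
    \sum_(a <- r) gr_mul (F a) w.
  exact: (big_morph (gr_mul^~ w) (fun _ _ => gr_mulDl _ _ _) (gr_mul0l _)).
have sumr w (r : {fset G}) F : gr_mul w (\sum_(a <- r) F a) =
    \sum_(a <- r) gr_mul w (F a).
  exact: (big_morph (gr_mul w) (fun _ _ => gr_mulDr _ _ _) (gr_mul0r _)).
move=> u v w; rewrite gr_mulEl (gr_mulEl u v) suml; apply: eq_bigr => a _.
rewrite (gr_mulEl v w) (gr_mulEr _ v) sumr suml; apply: eq_bigr => b _.
rewrite (gr_mulEr _ w) (gr_mulEr _ w) sumr; apply: eq_bigr => c _.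
by rewrite !gr_mulUU mulrA mulgA.
Qed.

Lemma gr_one_neq0 : gr_one != 0.
Proof.
by apply/eqP => /(congr1 (gcoef 1%g)) /eqP; rewrite monalg.mcoeffUU monalg.mcoeff0.
Qed.

HB.instance Definition _ := GRing.Zmodule_isNzRing.Build (group_ring G)
  gr_mulA gr_mul1l gr_mul1r gr_mulDl gr_mulDr gr_one_neq0.

End GroupRing.

Definition unitriangular : pred 'M[int]_3 :=
  fun A => [forall i : 'I_3, forall j : 'I_3, (j <= i)%N ==> (A i j == (i == j)%:R)].

Record heis : predArgType :=
  Heis { heis_val :> 'M[int]_3; _ : unitriangular heis_val }.
HB.instance Definition _ := [isSub for heis_val].
HB.instance Definition _ := [Choice of heis by <:].

Definition hmx (a b c : int) : 'M[int]_3 :=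
  \matrix_(i, j) nth 0 (nth [::] [:: [:: 1; a; c]; [:: 0; 1; b]; [:: 0; 0; 1]] i) j.

Lemma hmx_unitri a b c : unitriangular (hmx a b c).
Proof.
apply/forallP => -[[|[|[|i]]] hi] //; apply/forallP => -[[|[|[|j]]] hj] //;
  by apply/implyP => // _; rewrite mxE.
Qed.

Lemma unitriP (A : 'M[int]_3) :
  reflect (exists a b c, A = hmx a b c) (unitriangular A).
Proof.
apply: (iffP idP) => [/forallP hA|[a [b [c ->]]]]; last exact: hmx_unitri.
pose o k : 'I_3 := inord k.
exists (A (o 0%N) (o 1%N)), (A (o 1%N) (o 2%N)), (A (o 0%N) (o 2%N)).
have oE (i : 'I_3) : i = o (val i) by apply: val_inj; rewrite /= inordK.
apply/matrixP => i j; rewrite mxE.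
have /forallP/(_ j)/implyP := hA i.
rewrite (oE i) (oE j); case: i j => [[|[|[|i]]] hi] // [[|[|[|j]]] hj] //=;
  rewrite ?inordK// => /(_ isT)/eqP->//; by rewrite -val_eqE /= !inordK.
Qed.

Lemma hmxM a b c a' b' c' :
  hmx a b c *m hmx a' b' c' = hmx (a + a') (b + b') (c + c' + a * b').
Proof.
apply/matrixP => -[[|[|[|i]]] hi] // -[[|[|[|j]]] hj] //; rewrite !mxE;
  rewrite !big_ord_recl big_ord0 !mxE /=;
  ring.
Qed.

Lemma hmx1 : hmx 0 0 0 = 1%:M.
Proof.
by apply/matrixP => -[[|[|[|i]]] hi] // -[[|[|[|j]]] hj] //; rewrite !mxE.
Qed.

Lemma heis_mul_subproof (A B : heis) : unitriangular (A *m B).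
Proof.
case: A B => [A /= /unitriP [a [b [c eA]]]] [B /= /unitriP [a' [b' [c' eB]]]].
by rewrite eA eB hmxM hmx_unitri.
Qed.

Lemma heis_one_subproof : unitriangular (1%:M : 'M[int]_3).
Proof. by rewrite -hmx1 hmx_unitri. Qed.

Lemma hmx_unit a b c : hmx a b c \in unitmx.
Proof.
suff /mulmx1_unit[] : hmx a b c *m hmx (- a) (- b) (a * b - c) = 1%:M by [].
by rewrite hmxM -hmx1; congr hmx; ring.
Qed.

Lemma heis_unit (A : heis) : (A : 'M[int]_3) \in unitmx.
Proof. by case: A => A /= /unitriP [a [b [c ->]]]; exact: hmx_unit. Qed.

Lemma heis_inv_subproof (A : heis) : unitriangular (invmx A).
Proof.
case: A => A /= /unitriP [a [b [c ->]]].
rewrite [invmx _](_ : _ = hmx (- a) (- b) (a * b - c)) ?hmx_unitri//.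
apply: (can_inj (mulKmx (hmx_unit a b c))); rewrite mulmxV ?hmx_unit// hmxM -hmx1.
by congr hmx; ring.
Qed.

Definition heis_mul (A B : heis) : heis := Heis (heis_mul_subproof A B).
Definition heis_one : heis := Heis heis_one_subproof.
Definition heis_inv (A : heis) : heis := Heis (heis_inv_subproof A).

Lemma heis_mulA : associative heis_mul.
Proof. by move=> A B C; apply: val_inj; rewrite /= mulmxA. Qed.

Lemma heis_mul1 : left_id heis_one heis_mul.
Proof. by move=> A; apply: val_inj; rewrite /= mul1mx. Qed.

Lemma heis_1mul : right_id heis_one heis_mul.
Proof. by move=> A; apply: val_inj; rewrite /= mulmx1. Qed.

Lemma heis_mulV : left_inverse heis_one heis_inv heis_mul.
Proof. by move=> A; apply: val_inj; rewrite /= mulVmx// heis_unit. Qed.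

Lemma heis_Vmul : right_inverse heis_one heis_inv heis_mul.
Proof. by move=> A; apply: val_inj; rewrite /= mulmxV// heis_unit. Qed.

HB.instance Definition _ :=
  isGroup.Build heis heis_mulA heis_mul1 heis_1mul heis_mulV heis_Vmul.

Definition hx : heis := Heis (hmx_unitri 1 0 0).
Definition hy : heis := Heis (hmx_unitri 0 1 0).
Definition hz : heis := (hx * hy * hx^-1 * hy^-1)%g.

Definition gx : group_ring heis := gmono hx 1.

Lemma hzE : hz = Heis (hmx_unitri 0 0 1).
Proof.
apply: (canLR (mulgK _)); apply: (canLR (mulgK _)); apply: val_inj => /=.
by rewrite !hmxM; congr hmx; ring.
Qed.

Definition gexpz (G : groupType) (a : G) (m : int) : G :=
  match m with Posz n => (a ^+ n)%g | Negz n => (a ^- n.+1)%g end.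

(* g = \sum_(m, n) g_(m, n) Y^m Z^n is encoded by its coefficient function on
   Z^2. *)
Definition laurent : Type := monalg.malg (int * int)%type int.
HB.instance Definition _ :=
  GRing.Zmodule.copy laurent (monalg.malg (int * int)%type int).

Definition lpoly_yz (g : laurent) : group_ring heis :=
  \sum_(k <- gsupp g) gmono (gexpz hy k.1 * gexpz hz k.2)%g (gcoef k g).

Definition lpoly_eval (F : unitRingType) (g : laurent) (a b : F) : F :=
  \sum_(k <- gsupp g) (gcoef k g)%:~R * a ^ k.1 * b ^ k.2.

Definition integers (R : realType) : zmodClosed R :=
  (@Num.int_num_subdef R : {pred R}).

Definition torus (R : realType) : Type := Quotient.quot (integers R).

Section TorusTopology.
Variable R : realType.

HB.instance Definition _ := Quotient.on (torus R).
HB.instance Definition _ := GRing.Zmodule.on (torus R).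

(* The quotient topology. It is declared by hand because [quotient_topology]
   comes with a choiceType structure which differs from that of the quotient
   group. *)
Definition torus_open (U : set (torus R)) : Prop :=
  open (\pi_(torus R)%qT @^-1` U).

Let torus_openT : torus_open setT.
Proof. by rewrite /torus_open preimage_setT; exact: openT. Qed.

Let torus_openI : setI_closed torus_open.
Proof. by move=> A B; exact: openI. Qed.

Let torus_open_bigcup (I : Type) (f : I -> set (torus R)) :
  (forall i, torus_open (f i)) -> torus_open (\bigcup_i f i).
Proof. by move=> fo; apply: bigcup_open => i _; exact: fo. Qed.

HB.instance Definition _ := isOpenTopological.Build (torus R)
  torus_openT torus_openI torus_open_bigcup.

End TorusTopology.

Definition shift_space (R : realType) (G : groupType) : Type :=
  {ptws G -> torus R}.
HB.instance Definition _ R G := Topological.on (shift_space R G).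
HB.instance Definition _ R G :=
  GRing.Zmodule.copy (shift_space R G) (G -> torus R).

Section PrincipalAction.
Variables (R : realType) (G : groupType) (u : group_ring G).

Definition principal_set : set (shift_space R G) :=
  [set v | forall a', \sum_(a <- gsupp u) v (a' * a)%g *~ gcoef a u = 0].

Lemma principal_set_zmod : zmod_closed [in principal_set].
Proof.
split=> [|v w]; rewrite !inE => //.
  by move=> a'; rewrite big1// => a _; rewrite mul0rz.
move=> hv hw a'; transitivity
    (\sum_(a <- gsupp u) (v (a' * a)%g *~ gcoef a u - w (a' * a)%g *~ gcoef a u)).
  by apply: eq_bigr => a _; rewrite -mulrzBl.
by rewrite sumrB hv hw subrr.
Qed.

Definition principal_group : Type := set_type principal_set.
HB.instance Definition _ := Topological.on principal_group.
HB.instance Definition _ := SubChoice.on principal_group.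
HB.instance Definition _ := GRing.SubChoice_isSubZmodule.Build _ _
  principal_group principal_set_zmod.

Definition left_shift (b : G) (v : shift_space R G) : shift_space R G :=
  fun a' => v (b^-1 * a')%g.

Lemma left_shift_principal (b : G) (v : principal_group) :
  left_shift b (val v) \in principal_set.
Proof.
rewrite inE => a'; have := valP v; rewrite inE => /(_ (b^-1 * a')%g) {2}<-.
by apply: eq_bigr => a _; rewrite /left_shift mulgA.
Qed.

Definition principal_action (b : G) (v : principal_group) : principal_group :=
  exist _ (left_shift b (val v)) (left_shift_principal b v).

End PrincipalAction.

(* Nonnegativity of d follows from these clauses. *)
Definition compatible_metric (R : realType) (X : topologicalType)
    (d : X -> X -> R) : Prop :=
  [/\ forall x y, d x y = 0 <-> x = y,
      forall x y, d x y = d y x,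
      forall x y z, d x z <= d x y + d y z
    & forall x (A : set X), nbhs x A <->
        exists2 e : R, 0 < e & [set y | d x y < e] `<=` A].

Definition translation_invariant (R : realType) (X : zmodType)
    (d : X -> X -> R) : Prop :=
  forall x y z, d (x + z) (y + z) = d x y.

Definition expansive (R : realType) (G : groupType) (X : Type)
    (d : X -> X -> R) (alpha : G -> X -> X) : Prop :=
  exists2 e : R, 0 < e & forall v w, v <> w ->
    (e%:E < ereal_sup [set (d (alpha a v) (alpha a w))%:E | a in [set: G]])%E.

Section Circle.
Variable R : realType.
Local Open Scope complex_scope.

Definition circle : set R[i] := [set zeta | `|zeta| = 1].

Definition infinite_order (chi : R[i]) : Prop :=
  forall n, (0 < n)%N -> chi ^+ n != 1.

(* The normalised Lebesgue measure of the circle is the image of the Lebesgue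
   measure of [0, 1] under t |-> exp(2 pi i t). *)
Definition circle_integral (F : R[i] -> \bar R) : \bar R :=
  (\int[lebesgue_measure]_(t in `[0%R, 1%R])
     F (cos (2 * pi * t)%R +i* sin (2 * pi * t)%R))%E.

Definition zeros (chi : R[i]) (g : laurent) : set R[i] :=
  circle `&` [set zeta | lpoly_eval g zeta chi = 0].

(* Division by 0 yields 0, so that psi and phi take the values 0 and -oo at the
   poles. If the denominator does not vanish identically on the circle, the
   poles form a finite set and do not affect the integral of phi. *)
Definition psi (g0 g1 : laurent) (chi zeta : R[i]) : R[i] :=
  lpoly_eval g0 zeta chi / lpoly_eval g1 (zeta * chi^-1) chi.

Definition phi (g0 g1 : laurent) (chi zeta : R[i]) : \bar R :=
  lne (complex.Re `|psi g0 g1 chi zeta|)%:E.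

End Circle.

(* Main.v *)
Require Import Defs.
From HB Require Import structures.
From mathcomp Require Import all_boot all_order all_algebra finmap.
From mathcomp Require Import generic_quotient ring_quotient.
From mathcomp Require Import all_classical all_reals all_analysis.
From mathcomp Require Import measurable_realfun complex.
From mathcomp Require Import ring lra zify.
From mathcomp Require multinomials.monalg.
Import (canonicals) multinomials.monalg.

(** A bounded nonzero real solution w of [sum_a f_a w(b a) = 0] makes alpha_f
    non-expansive: the points [w / n mod 1] of X_f are nonzero and uniformly
    small along their whole orbit. For [w = Re (chi^c zeta^b u_a)] at the group
    element y^b z^c x^a, the equation reads
      g1(zeta chi^a, chi) u_(a+1) = g0(zeta chi^a, chi) u_a.
    In case (i), take zeta chi^-1 so close to a zero of g1 that u is small,
    relative to u_0, at times -N, ..., -1. As the integral of phi is negative,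
    some orbit of the rotation by chi has very negative Birkhoff sums of phi;
    as phi is bounded below and every orbit visits a given arc after a bounded
    time, zeta can be chosen such that moreover u is small at some late time.
    Shifting to the time where |u| is maximal gives solutions with |u| <= 1 and
    u_0 = 1 on windows [-N, N], and these have a limit along an ultrafilter.
    Since u is never followed to infinity, the possibly very close returns of
    chi^n to 1 do no harm. Case (ii) is case (i) with time reversed. *)

Set Implicit Arguments.
Unset Strict Implicit.
Unset Printing Implicit Defensive.

Import Order.TTheory GRing.Theory Num.Theory.
Import numFieldNormedType.Exports.

Local Open Scope classical_set_scope.
Local Open Scope ring_scope.

(** * Non-expansiveness from a bounded real solution *)

Lemma shift_space_cvg (R : realType) (G : groupType) (x : nat -> shift_space R G)
    (l : shift_space R G) :
  (forall a : G, x n a @[n --> \oo] --> l a) -> x @ \oo --> l.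
Proof.
move=> xl; apply/cvg_sup => a A /=.
move=> [_ [[B oB <-] Bl BA]].
have nB : nbhs (l a) B by exact: open_nbhs_nbhs.
have [N _ NB] := xl a _ nB.
by exists N => // n /NB /BA.
Qed.

Lemma torus_pi_continuous (R : realType) : continuous (\pi_(torus R)%qT : R -> torus R).
Proof. by apply/continuousP => A. Qed.

Lemma principal_group_cvg (R : realType) (G : groupType) (u : group_ring G)
    (x : nat -> principal_group R u) (l : principal_group R u) :
  (forall a : G, (val (x n) : shift_space R G) a @[n --> \oo] -->
     (val l : shift_space R G) a) ->
  x @ \oo --> l.
Proof.
move=> /shift_space_cvg xl A [_ [[C oC <-] Cl CA]].
have nC : nbhs (val l) C by exact: open_nbhs_nbhs.
have [N _ NC] := xl _ nC.
by exists N => // n /NC /CA.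
Qed.

Lemma torus_piMz (R : realType) (r : R) (m : int) :
  (\pi_(torus R)%qT r : torus R) *~ m = \pi_(torus R)%qT (r * m%:~R).
Proof. by rewrite mulrzr raddfMz. Qed.

Lemma torus_pi_eq0 (R : realType) (r : R) :
  (\pi_(torus R)%qT r : torus R) = 0 -> r \is a Num.int.
Proof.
move=> r0; have : (r == 0 %[mod Quotient.quot (integers R)])%qT.
  by apply/eqP; exact: etrans r0 (esym (raddf0 \pi_(torus R)%qT)).
by rewrite -Quotient.idealrBE subr0.
Qed.

(* If every point w / n mod 1 could be moved to distance e from 0, these
   translates would still tend to 0 coordinatewise, hence in X_u. *)
Lemma not_expansive_of_kernel (R : realType) (G : groupType) (u : group_ring G)
    (d : principal_group R u -> principal_group R u -> R) (w : G -> R) :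
  compatible_metric d ->
  (forall a, `|w a| <= 1) -> w 1%g = 1 ->
  (forall b, \sum_(a <- gsupp u) (gcoef a u)%:~R * w (b * a)%g = 0) ->
  ~ expansive d (@principal_action R G u).
Proof.
move=> [d0 dC _ dnbhs] w1 w11 wu [e e0 exp].
(* The denominators start at 2, so that the value 1 / (n + 2) at the identity is not an integer and
   the point is nonzero in X_u. *)
pose v n : shift_space R G := fun a => \pi_(torus R)%qT (w a / n.+2%:R).
have vu n : v n \in @principal_set R G u.
  rewrite inE => b; rewrite /v.
  transitivity (\pi_(torus R)%qT
      (\sum_(a <- gsupp u) w (b * a)%g / n.+2%:R * (gcoef a u)%:~R) : torus R).
    by rewrite raddf_sum; apply: eq_bigr => a _; rewrite torus_piMz.
  rewrite [X in \pi_(torus R)%qT X](_ : _ = 0); first exact: raddf0.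
  transitivity ((\sum_(a <- gsupp u) (gcoef a u)%:~R * w (b * a)%g) / n.+2%:R).
    by rewrite mulr_suml; apply: eq_bigr => a _; rewrite mulrC mulrA.
  by rewrite wu mul0r.
pose V n : principal_group R u := exist _ (v n) (vu n).
have V0 n : V n <> 0.
  move=> /(congr1 (fun x : principal_group R u => (val x : shift_space R G) 1%g)) /=.
  rewrite /v w11 => /torus_pi_eq0; rewrite mul1r => /norm_intr_ge1 /(_ _).
  rewrite invr_eq0 pnatr_eq0 normfV normr_nat => /(_ isT).
  by rewrite invf_ge1 ?ltr0n// (ler_nat _ n.+2 1).
have ex n : exists a, e < d (principal_action a (V n)) (principal_action a 0).
  have /ereal_sup_gt [_ [a _ <-]] := exp _ _ (V0 n).
  by rewrite lte_fin => ?; exists a.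
pose g n := projT1 (cid (ex n)).
have gP n : e < d (principal_action (g n) (V n)) 0.
  have := projT2 (cid (ex n)); rewrite -/(g n).
  rewrite [X in d _ X](_ : _ = 0)//; apply: val_inj.
  exact: (congr1 (left_shift (g n)) (raddf0 val)).
have : (fun n => principal_action (g n) (V n)) @ \oo --> (0 : principal_group R u).
  apply: principal_group_cvg => a.
  rewrite [X in _ --> X](_ : _ = \pi_(torus R)%qT (0 : R)); last first.
    transitivity (0 : torus R); last exact: esym (raddf0 \pi_(torus R)%qT).
    exact: (congr1 (fun g : shift_space R G => g a) (raddf0 val)).
  rewrite /= /left_shift /v.
  apply: (@continuous_cvg _ _ _ _ _ _ \pi_(torus R)%qT); first exact: torus_pi_continuous.
  apply: norm_cvg0; apply: (@squeeze_cvgr _ _ _ _ (fun=> 0) harmonic).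
  - near=> k; rewrite normr_ge0 /= normrM normfV normr_nat.
    apply: le_trans (ler_pM _ _ (w1 _) (lexx _)) _ => //.
    by rewrite mul1r lef_pV2 ?posrE// ler_nat.
  - exact: cvg_cst.
  - exact: cvg_harmonic.
have /dnbhs : exists2 r : R, 0 < r & [set y | d 0 y < r] `<=` [set y | d 0 y < e].
  by exists e.
move=> n0 /(_ _ n0) [N _ /(_ N (leqnn _))] /=.
by rewrite dC => /(lt_trans (gP N)); rewrite ltxx.
Unshelve. all: by end_near. Qed.

(** * Limits of approximate solutions along an ultrafilter *)

Lemma fmap_ultra (T U : Type) (f : T -> U) (F : set_system T) :
  UltraFilter F -> UltraFilter (f @ F).
Proof.
move=> FU; split; first exact: fmap_proper_filter.
move=> H HF FH; rewrite predeqE => A; split=> [HA|]; last exact: FH.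
have [//|FnA] := in_ultra_setVsetC (f @^-1` A) FU.
have /FH HnA : (f @ F) (~` A) by [].
have := @filterI _ H _ _ _ HA HnA; rewrite setICr => H0.
by have [] := @filter_ex _ H _ _ (H0 _).
Qed.

(** Each coordinate eventually lies in the compact interval [-1, 1], so it converges along an
    ultrafilter finer than [\oo]. The equation at [b] involves finitely many coordinates and holds
    eventually, hence it passes to the limit. *)
Lemma kernel_of_approximations (R : realType) (G : groupType) (u : group_ring G)
    (w : nat -> G -> R) :
  (forall a, \forall n \near \oo, `|w n a| <= 1) -> (forall n, w n 1%g = 1) ->
  (forall b, \forall n \near \oo,
     \sum_(a <- gsupp u) (gcoef a u)%:~R * w n (b * a)%g = 0) ->
  exists w' : G -> R, [/\ forall a, `|w' a| <= 1, w' 1%g = 1 &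
    forall b, \sum_(a <- gsupp u) (gcoef a u)%:~R * w' (b * a)%g = 0].
Proof.
move=> w1 w11 wu.
have [U [UU ooU]] := @ultraFilterLemma nat \oo _.
have lim a : exists l : R, `|l| <= 1 /\ w n a @[n --> U] --> l.
  have Ucpt := @segment_compact R (-1) 1; rewrite compact_ultra in Ucpt.
  have [||l []] := Ucpt (w n a @[n --> U]).
  - exact: fmap_ultra.
  - apply: ooU; apply: filterS (w1 a) => n /=.
    by rewrite in_itv /= ler_norml.
  - by rewrite /= in_itv /= -ler_norml => l1 lU; exists l.
have /choice[w' w'P] := lim.
exists w'; split=> [a||b]; first by case: (w'P a).
- have [_] := w'P 1%g; under eq_cvg do rewrite w11.
  by move/cvg_lim <- => //; rewrite lim_cst.
- have cv : \sum_(a <- gsupp u) (gcoef a u)%:~R * w n (b * a)%g @[n --> U] -->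
      \sum_(a <- gsupp u) (gcoef a u)%:~R * w' (b * a)%g.
    elim: (enum_fset (gsupp u)) => [|a s IHs].
      by under eq_cvg do rewrite big_nil; rewrite big_nil; exact: cvg_cst.
    under eq_cvg do rewrite big_cons.
    rewrite big_cons; apply: cvgD => //; apply: cvgMl_tmp.
    by have [] := w'P (b * a)%g.
  move/cvg_lim : (cv) => <- //.
  apply: (@lim_near_cst R^o) => //.
  exact: ooU (wu b).
Qed.

(** * The real-valued modulus of complex numbers *)

(** The norm on [R[i]] has values in [R[i]]; its real part is the modulus as an element of [R], to
    be used with real inequalities, logarithms and integrals. *)
Definition cabs (R : realType) (z : R[i]) : R := complex.Re `|z|.
Arguments cabs : simpl never.

Section ComplexModulus.
Variable R : realType.
Implicit Types z w : R[i].

Lemma ReD z w : complex.Re (z + w) = complex.Re z + complex.Re w.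
Proof. by case: z w => ? ? []. Qed.

Lemma ImD z w : complex.Im (z + w) = complex.Im z + complex.Im w.
Proof. by case: z w => ? ? []. Qed.

Lemma ReM z w :
  complex.Re (z * w) = complex.Re z * complex.Re w - complex.Im z * complex.Im w.
Proof. by case: z w => ? ? []. Qed.

Lemma ImM z w :
  complex.Im (z * w) = complex.Re z * complex.Im w + complex.Im z * complex.Re w.
Proof. by case: z w => ? ? []. Qed.

Lemma cabsM z w : cabs (z * w) = cabs z * cabs w.
Proof. exact: ComplexField.Normc.normcM. Qed.

Lemma cabs0 : cabs (0 : R[i]) = 0.
Proof. exact: ComplexField.Normc.normc0. Qed.

Lemma cabs1 : cabs (1 : R[i]) = 1.
Proof. exact: ComplexField.Normc.normc1. Qed.

Lemma cabs_eq0 z : (cabs z == 0) = (z == 0).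
Proof.
by apply/eqP/eqP => [|->]; [exact: ComplexField.Normc.eq0_normc|exact: cabs0].
Qed.

Lemma cabs_ge0 z : 0 <= cabs z.
Proof. by case: z => a b; exact: sqrtr_ge0. Qed.

Lemma cabs_gt0 z : z != 0 -> 0 < cabs z.
Proof. by move=> z0; rewrite lt_neqAle cabs_ge0 eq_sym cabs_eq0 z0. Qed.

Lemma cabsV z : cabs z^-1 = (cabs z)^-1.
Proof. exact: ComplexField.Normc.normcV. Qed.

Lemma cabs_prod (n : nat) (F : 'I_n -> R[i]) :
  cabs (\prod_(j < n) F j) = \prod_(j < n) cabs (F j).
Proof. exact: (big_morph _ cabsM cabs1). Qed.

Lemma Re_le_cabs z : `|complex.Re z| <= cabs z.
Proof.
case: z => a b; rewrite /cabs /= -[leLHS]ger0_norm ?normr_ge0// -sqrtr_sqr.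
by rewrite real_normK ?num_real// ler_wsqrtr// lerDl sqr_ge0.
Qed.

End ComplexModulus.

(** * Solutions of the recurrence on a finite window *)

Section Window.
Variables (R : realType) (p q : int -> R[i]) (m C : R).
Hypotheses (m_gt0 : 0 < m) (mC : m <= C).
Hypotheses (mp : forall a, m <= cabs (p a)) (qC : forall a, cabs (q a) <= C).

Let p_neq0 a : p a != 0.
Proof. by rewrite -cabs_eq0 gt_eqF// (lt_le_trans m_gt0). Qed.

Let Cm_ge1 : 1 <= C / m. Proof. by rewrite ler_pdivlMr// mul1r. Qed.

(* The solution u of [q a * u (a + 1) = p a * u a] with u 0 = 1: it always
   extends to the left, and to the right as long as q does not vanish. *)
Definition half_orbit (a : int) : R[i] :=
  match a with
  | Posz n => \prod_(j < n) (p j / q j)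
  | Negz n => \prod_(j < n.+1) (q (Negz j) / p (Negz j))
  end.

Lemma half_orbit_pos (n : nat) : q n != 0 ->
  q n * half_orbit n.+1 = p n * half_orbit n.
Proof.
move=> qn; rewrite /half_orbit big_ord_recr /= mulrCA [q _ * _]mulrC divfK//.
exact: mulrC.
Qed.

Lemma half_orbit_neg (n : nat) :
  q (Negz n) * half_orbit (Negz n + 1) = p (Negz n) * half_orbit (Negz n).
Proof.
rewrite [half_orbit (Negz n)]/half_orbit big_ord_recr /=.
rewrite mulrCA [p _ * _]mulrC divfK// mulrC.
congr (_ * _); case: n => [|n]; first by rewrite /= !big_ord0.
by have -> : Negz n.+1 + 1 = Negz n by lia.
Qed.

(** The first step into the past contributes the factor |q(-1)| / |p(-1)| and each later one at most
    C / m. A small [q (-1)] therefore makes a whole stretch of the past small. *)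
Lemma half_orbit_neg_le (n : nat) :
  cabs (half_orbit (Negz n)) <= cabs (q (-1)) / m * (C / m) ^+ n.
Proof.
elim: n => [|n IHn].
  rewrite expr0 mulr1 /= big_ord_recl big_ord0 mulr1 cabsM cabsV.
  by rewrite ler_wpM2l ?cabs_ge0// lef_pV2 ?posrE// (lt_le_trans m_gt0).
rewrite [half_orbit _]big_ord_recr /= cabsM exprSr mulrA ler_pM ?cabs_ge0//.
rewrite cabsM cabsV ler_pM ?invr_ge0 ?cabs_ge0//.
by rewrite lef_pV2 ?posrE// (lt_le_trans m_gt0).
Qed.

(** The half orbit starts at 1, is small just before time 0 because [q (-1)] is small, and is small
    near the end of the product because of the last hypothesis. Its maximum over the times in
    between is thus attained far from the right end, and dividing by the value there gives the
    window. The index [j - 1] on the right matches the argument zeta chi^-1 of g1 in phi. *)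
Lemma window_solution (N M : nat) (e : R) :
  cabs (q (-1)) * (C / m) ^+ N <= m -> e * (C / m) ^+ N.+1 < 1 ->
  \prod_(j < M) cabs (p j) <= e * \prod_(j < M) cabs (q (j%:Z - 1)) ->
  exists (s : nat) (u : int -> R[i]), [/\ u 0 = 1,
    forall a, (`|a| <= N)%N -> cabs (u a) <= 1 &
    forall a, - N%:Z <= a < N%:Z -> q (s%:Z + a) * u (a + 1) = p (s%:Z + a) * u a].
Proof.
move=> q1 e1 pq.
have Cm0 n : 0 < (C / m) ^+ n by rewrite exprn_gt0// (lt_le_trans ltr01).
have pp n : 0 < \prod_(j < n) cabs (p j).
  by apply: prodr_gt0 => j _; rewrite (lt_le_trans m_gt0).
have e0 : 0 <= e.
  rewrite leNgt; apply/negP => e0; have := lt_le_trans (pp M) pq.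
  by rewrite ltNge mulr_le0_ge0 ?(ltW e0)// prodr_ge0// => j _; exact: cabs_ge0.
(* Empty products would give 1 <= e, against [e1]. From here on, [M] is one less than the number of
   factors. *)
case: M pq => [|M] pq.
  suff : e < 1 by move: pq; rewrite !big_ord0 mulr1 leNgt => /negP.
  by rewrite (le_lt_trans _ e1)// ler_peMr// exprn_ege1.
(* The product of the p's is positive, so no factor on the right of [pq] vanishes; hence
   [half_orbit] solves the recurrence up to time [M]. *)
have q_neq0 (n : nat) : (n < M)%N -> q n != 0.
  move=> nM; have nM' : (n.+1 < M.+1)%N by [].
  have : \prod_(j < M.+1) cabs (q (j%:Z - 1)) != 0.
    by apply: contraTneq (lt_le_trans (pp M.+1) pq) => ->; rewrite mulr0 ltxx.
  move=> /prodf_neq0/(_ (Ordinal nM') isT) /=.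
  have -> : n.+1%:Z - 1 = n by lia.
  by rewrite cabs_eq0.
have Ueq (a : int) : a < M%:Z -> q a * half_orbit (a + 1) = p a * half_orbit a.
  case: a => [n nM|n _]; last exact: half_orbit_neg.
  have -> : Posz n + 1 = n.+1 by lia.
  by rewrite half_orbit_pos// q_neq0.
(* The product over q splits into |q(-1)| and the denominator of |u_M|. Cancelling that denominator
   leaves |u_M| |p_M| <= e |q(-1)| <= e C. *)
have UM : cabs (half_orbit M) <= e * (C / m).
  have h n : (n <= M)%N ->
      cabs (half_orbit n) * \prod_(j < n) cabs (q j) = \prod_(j < n) cabs (p j).
    move=> nM; rewrite [half_orbit _]/= cabs_prod -big_split /=.
    apply: eq_bigr => j _; rewrite cabsM cabsV divfK// cabs_eq0 q_neq0//.
    exact: leq_trans (ltn_ord j) nM.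
  move: pq; rewrite big_ord_recr /= -h// big_ord_recl /=.
  under [in X in _ <= e * (_ * X)]eq_bigr => j _.
    have -> : (bump 0 j)%:Z - 1 = j by rewrite /bump; lia.
    over.
  have P0 : 0 < \prod_(i < M) cabs (q i).
    by apply: prodr_gt0 => j _; rewrite cabs_gt0// q_neq0.
  rewrite mulrAC [X in _ <= _ * X]mulrC [X in _ <= X]mulrCA mulrC ler_pM2l// => hM.
  have : cabs (half_orbit M) * m <= e * C.
    apply: le_trans (ler_wpM2l (cabs_ge0 _) (mp M)) _.
    apply: le_trans hM _; rewrite ler_wpM2l//.
  by rewrite mulrA ler_pdivlMr.
(* A step back multiplies the modulus by at most C / m. With the factor C / m of [UM], the exponent
   N + 1 in [e1] covers the last N + 1 times. *)
have Utop (i : nat) : (i <= N)%N -> (i <= M)%N -> cabs (half_orbit (M - i)%N) < 1.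
  move=> iN iM; apply: le_lt_trans e1.
  suff : cabs (half_orbit (M - i)%N) <= e * (C / m) ^+ i.+1.
    move/le_trans; apply; rewrite ler_wpM2l// ler_weXn2l//.
  elim: i iM {iN} => [|i IHi] iM; first by rewrite subn0 expr1.
  have := Ueq (M - i.+1)%N%:Z; have -> : (M - i.+1)%N%:Z + 1 = (M - i)%N by lia.
  have kM : (M - i.+1)%N%:Z < M%:Z by lia.
  move=> /(_ kM)/(congr1 (@cabs R)); rewrite !cabsM => h.
  rewrite exprSr mulrA mulrA ler_pdivlMr//.
  apply: le_trans (ler_wpM2l (cabs_ge0 _) (mp (M - i.+1)%N%:Z)) _.
  rewrite mulrC -h [X in _ <= X]mulrC ler_pM ?cabs_ge0//.
  exact: IHi (ltnW iM).
(* The maximum is at least |u_0| = 1, which by [Utop] keeps its position [s] away from the last N +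
   1 times. *)
pose F (s : 'I_M.+1) := cabs (half_orbit s).
have [s _ sP] := @arg_maxP _ _ _ ord0 xpredT F erefl.
have s1 : 1 <= F s.
  have F0 : F ord0 = 1 by rewrite /F [half_orbit _]/= big_ord0 cabs1.
  by rewrite -F0; exact: sP.
have sN : (s + N < M)%N.
  rewrite ltnNge; apply/negP => MsN.
  have sM : (s <= M)%N by rewrite -ltnS ltn_ord.
  have MsN' : (M - s <= N)%N by rewrite leq_subLR.
  have := Utop _ MsN' (leq_subr _ _); rewrite subKn// => /(le_lt_trans s1).
  by rewrite ltxx.
have s0 : half_orbit s != 0 by rewrite -cabs_eq0 gt_eqF// (lt_le_trans ltr01).
exists s, (fun a => half_orbit (s%:Z + a) / half_orbit s); split.
- by rewrite addr0 divff.
- move=> a aN; rewrite cabsM cabsV ler_pdivrMr ?mul1r ?(lt_le_trans ltr01)//.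
  case sa : (s%:Z + a) => [n|n].
    have nM : (n < M.+1)%N by lia.
    by have := sP (Ordinal nM) erefl.
  apply: le_trans s1; apply: le_trans (half_orbit_neg_le _) _.
  rewrite mulrAC ler_pdivrMr// mul1r; apply: le_trans q1.
  by rewrite ler_wpM2l ?cabs_ge0// ler_weXn2l//; lia.
- move=> a aN; rewrite addrA !mulrA Ueq//; lia.
Qed.
End Window.

(** * Density of irrational rotations, with a bounded waiting time *)

Section Dirichlet.
Variables (R : realType) (theta : R).
Hypothesis theta_irr : forall n, (0 < n)%N -> n%:R * theta \isn't a Num.int.

Let frac (x : R) := x - (Num.floor x)%:~R.

Let frac_ge0 x : 0 <= frac x. Proof. by rewrite subr_ge0 floor_le_tmp. Qed.
Let frac_lt1 x : frac x < 1.
Proof. by rewrite ltrBlDl; have := floorD1_gt x; rewrite intrD. Qed.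

(** Pigeonhole: two of K + 1 multiples of theta have fractional parts in the same interval of length
    1 / K < delta. Their difference is nonzero modulo 1 by irrationality. *)
Lemma dirichlet_approximation (delta : R) : 0 < delta ->
  exists (n : nat) (p : int), 0 < `|n%:R * theta - p%:~R| < delta.
Proof.
move=> d0; pose K := (Num.truncn delta^-1).+1.
have Kd : K%:R^-1 < delta.
  by rewrite -[ltRHS]invrK ltf_pV2 ?posrE ?invr_gt0// truncnS_gt.
have K0 : 0 < K%:R :> R by rewrite ltr0n.
have fP (j : 'I_K.+1) : (Num.truncn (K%:R * frac (j%:R * theta)) < K)%N.
  by rewrite truncn_lt_nat ?mulr_ge0// gtr_pMr.
pose f j := Ordinal (fP j).
have [f_inj|] := boolP (injectiveb f).
  by have /leq_card := injectiveP _ f_inj; rewrite !card_ord ltnn.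
have close (j k : 'I_K.+1) : (j < k)%N -> f j = f k ->
    exists (n : nat) (p : int), 0 < `|n%:R * theta - p%:~R| < delta.
  move=> jk /(congr1 val) /= fjk.
  exists (k - j)%N, (Num.floor (k%:R * theta) - Num.floor (j%:R * theta)).
  have -> : (k - j)%N%:R * theta -
      (Num.floor (k%:R * theta) - Num.floor (j%:R * theta))%:~R =
      frac (k%:R * theta) - frac (j%:R * theta) :> R.
    by rewrite natrB ?(ltnW jk)// intrB /frac; ring.
  apply/andP; split.
    have kj : (0 < k - j)%N by rewrite subn_gt0.
    rewrite normr_gt0 subr_eq0; apply: contraNN (theta_irr kj).
    rewrite natrB ?(ltnW jk)// mulrBl /frac => /eqP h.
    have -> : k%:R * theta - j%:R * theta =
      (Num.floor (k%:R * theta) - Num.floor (j%:R * theta))%:~R :> R.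
      by rewrite intrB; lra.
    exact: intr_int.
  apply: lt_trans Kd; rewrite -(ltr_pM2l K0) divff ?gt_eqF//.
  have /andP[k1 k2] := truncn_itv (mulr_ge0 (ltW K0) (frac_ge0 (k%:R * theta))).
  have /andP[j1 j2] := truncn_itv (mulr_ge0 (ltW K0) (frac_ge0 (j%:R * theta))).
  rewrite -[X in X * _](gtr0_norm K0) -normrM mulrBr ltr_norml.
  rewrite -fjk -natr1 in k1 k2; rewrite -natr1 in j2.
  by apply/andP; split; lra.
move=> /injectivePn[j [k jk fjk]].
case: (ltngtP j k) => [|kj|/val_inj]; [by move/close; apply| |].
  by apply: (close k j).
by move/eqP; rewrite (negbTE jk).
Qed.

(** Every n steps of the rotation move a point by the same nonzero amount [a] with |a| < delta
    modulo 1. At most 1 / |a| such moves come close to any target, so the bound on the time is the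
    same for all [t] and [t0]. *)
Lemma irrational_rotation_dense (delta : R) : 0 < delta -> exists N : nat,
  forall t t0 : R, exists (j : nat) (k : int),
    (j <= N)%N /\ `|t + j%:R * theta - t0 - k%:~R| < delta.
Proof.
move=> /dirichlet_approximation [n [p /andP[]]].
set a := n%:R * theta - p%:~R => a0 ad.
have steps (x : R) : exists2 j : nat, (j <= Num.truncn `|a|^-1)%N &
    `|frac x - j%:R * `|a| | < delta.
  pose j := Num.truncn (frac x / `|a|); exists j.
    by apply: le_truncn; rewrite ler_piMl ?invr_ge0// ltW.
  apply: le_lt_trans ad.
  have /andP[j1 j2] := truncn_itv (divr_ge0 (frac_ge0 x) (ltW a0)).
  rewrite -/j ler_pdivlMr// in j1; rewrite -/j ltr_pdivrMr// -natr1 in j2.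
  by rewrite ler_norml; apply/andP; split; lra.
have natn (j : nat) : (j * n)%:R * theta = j%:R * a + (j%:Z * p)%:~R :> R.
  by rewrite /a intrM natrM; ring.
exists (Num.truncn `|a|^-1 * n)%N => t t0.
(* The sign of [a] decides the direction: the distance to be covered is the fractional part of t0 -
   t if [a] is nonnegative, and that of t - t0 otherwise. *)
have [ap|an] := leP 0 a.
  have [j jN jx] := steps (t0 - t); exists (j * n)%N, (j%:Z * p - Num.floor (t0 - t)).
  split; first by rewrite leq_mul2r jN orbT.
  move: jx; rewrite distrC natn intrB (ger0_norm ap) /frac.
  rewrite (_ : j%:R * a - _ = t + (j%:R * a + (j%:Z * p)%:~R) - t0 -
    ((j%:Z * p)%:~R - (Num.floor (t0 - t))%:~R)) //; ring.
have [j jN jx] := steps (t - t0); exists (j * n)%N, (j%:Z * p + Num.floor (t - t0)).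
split; first by rewrite leq_mul2r jN orbT.
move: jx; rewrite natn intrD (ltr0_norm an) /frac.
rewrite (_ : _ - j%:R * - a = t + (j%:R * a + (j%:Z * p)%:~R) - t0 -
  ((j%:Z * p)%:~R + (Num.floor (t - t0))%:~R)) //; ring.
Qed.
End Dirichlet.

(** * Periodic functions: extrema and integrals over a period *)

Lemma periodic_intr (R : realType) (T : Type) (P : R -> T) :
  (forall t, P (t + 1) = P t) -> forall (n : int) t, P (t + n%:~R) = P t.
Proof.
move=> P1; have Pn (k : nat) u : P (u + k%:R) = P u.
  by elim: k => [|k IHk]; rewrite ?addr0// -natr1 addrA P1.
case=> n t; first exact: Pn.
by rewrite NegzE mulrNz -[LHS](Pn n.+1) subrK.
Qed.

Lemma periodic_extrema (R : realType) (P : R -> R) : continuous P ->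
  (forall t, P (t + 1) = P t) -> exists t0 t1, forall t, P t0 <= P t <= P t1.
Proof.
move=> cP P1.
have cP01 : {within `[0, 1], continuous P} by exact: continuous_subspaceT.
have [t0 _ t0P] := EVT_min ler01 cP01; have [t1 _ t1P] := EVT_max ler01 cP01.
exists t0, t1 => t.
rewrite -[t](subrK (Num.floor t)%:~R) periodic_intr//.
have t01 : t - (Num.floor t)%:~R \in `[0, 1]%R.
  rewrite in_itv /= subr_ge0 floor_le_tmp lerBlDl /=.
  by have := floorD1_gt t; rewrite intrD => /ltW.
by rewrite t0P// t1P.
Qed.

Section PeriodicIntegral.
Variable R : realType.
Local Notation mu := (@lebesgue_measure R).

Lemma continuous_integrable_itv (P : R -> R) (a b : R) : continuous P ->
  mu.-integrable `[a, b] (EFin \o P).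
Proof.
move=> cP; apply: continuous_compact_integrable; first exact: segment_compact.
exact: continuous_subspaceT.
Qed.

Lemma Rintegral_translate (P : R -> R) (a b s : R) : a <= b -> continuous P ->
  \int[mu]_(t in `[a + s, b + s]) P t = \int[mu]_(t in `[a, b]) P (t + s).
Proof.
move=> ab cP; rewrite /Rintegral.
have dF (x : R) : is_derive x 1 (fun t : R => t + s) 1.
  by apply: is_derive_eq; rewrite addr0.
have F' : derive1 (fun t : R => t + s) = cst 1.
  by apply/funext => x; rewrite derive1E; exact: derive_val.
have cF (x : R) : {for x, continuous (fun t : R => t + s)}.
  by apply: cvgD; [exact: cvg_id|exact: cvg_cst].
rewrite (@integration_by_substitution_increasing R (fun t => t + s) P a b)//.
- congr fine; apply: eq_integral => t _; rewrite F' /=.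
  by congr EFin; rewrite [LHS]mulr1.
- by move=> x y _ _ xy; rewrite ltrD2r.
- by rewrite F' => x _; exact: cvg_cst.
- by rewrite F'; exact: is_cvg_cst.
- by rewrite F'; exact: is_cvg_cst.
- split; [by move=> x _; have [] := dF x| |].
    exact: cvg_at_right_filter (cF a).
  exact: cvg_at_left_filter (cF b).
- exact: continuous_subspaceT.
Qed.

Lemma Rintegral_itv_split (P : R -> R) (a b c : R) : a <= b -> b <= c ->
  continuous P ->
  \int[mu]_(t in `[a, c]) P t = \int[mu]_(t in `[a, b]) P t + \int[mu]_(t in `[b, c]) P t.
Proof.
move=> ab bc cP; rewrite -[X in _ + X]Rintegral_itv_obnd_cbnd.
  rewrite -(@Rintegral_itvB _ P (BLeft a) (BRight c)) ?bnd_simp//.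
    by rewrite addrC subrK.
  exact: continuous_integrable_itv.
apply: integrableS (continuous_integrable_itv b c cP) => //.
by apply: subset_itv; rewrite bnd_simp.
Qed.

(** Reduce [s] to its fractional part r. The integral over [r, 1 + r] is split at 1, and by
    periodicity the piece over [1, 1 + r] equals the one over [0, r]. *)
Lemma Rintegral_rotation (P : R -> R) (s : R) : continuous P ->
  (forall t, P (t + 1) = P t) ->
  \int[mu]_(t in `[0, 1]) P (t + s) = \int[mu]_(t in `[0, 1]) P t.
Proof.
move=> cP P1.
have Pz := periodic_intr P1.
pose r := s - (Num.floor s)%:~R.
have r0 : 0 <= r by rewrite subr_ge0 floor_le_tmp.
have r1 : r <= 1 by rewrite lerBlDl; have := floorD1_gt s; rewrite intrD => /ltW.
have -> : \int[mu]_(t in `[0, 1]) P (t + s) = \int[mu]_(t in `[0, 1]) P (t + r).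
  by apply: eq_Rintegral => t _; rewrite -(Pz (Num.floor s) (t + r)) -addrA subrK.
rewrite -Rintegral_translate// (@Rintegral_itv_split P _ 1) ?add0r ?lerDl//.
rewrite (@Rintegral_itv_split P 0 r 1)// addrC; congr (_ + _).
rewrite -[X in `[X, _]](add0r 1) [1 + r]addrC Rintegral_translate//.
exact: eq_Rintegral.
Qed.

End PeriodicIntegral.

(** * Orbits with very negative Birkhoff sums *)

(** When the product is expanded, all terms but the main one contain a factor e. The constant [K] is
    chosen before [b] and [e], hence is uniform along all orbits. *)
Lemma prod_add_le (R : realType) (C : R) (M : nat) : 0 <= C ->
  exists2 K : R, 0 <= K & forall (b : nat -> R) (e : R), 0 <= e <= 1 ->
    (forall j, 0 <= b j <= C) ->
    \prod_(j < M) (b j + e) <= \prod_(j < M) b j + e * K.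
Proof.
move=> C0; elim: M => [|M [K K0 IHM]].
  by exists 0 => // b e _ _; rewrite !big_ord0 mulr0 addr0.
exists (C ^+ M + K * (C + 1)) => [|b e /andP[e0 e1] bC].
  by rewrite addr_ge0 ?exprn_ge0// mulr_ge0// addr_ge0.
have /andP[b0 bMC] := bC M.
rewrite !big_ord_recr /=.
have P0 : 0 <= \prod_(j < M) b j by apply: prodr_ge0 => j _; case/andP: (bC j).
have PC : \prod_(j < M) b j <= C ^+ M.
  rewrite -[M in X in _ <= X]card_ord -prodr_const; apply: ler_prod => j _; exact: bC.
have IH : \prod_(j < M) (b j + e) <= \prod_(j < M) b j + e * K.
  by apply: IHM => //; rewrite e0.
apply: le_trans (ler_wpM2r (addr_ge0 b0 e0) IH) _.
rewrite mulrDl mulrDr -addrA lerD2l [e * (_ + _)]mulrDr [_ * e]mulrC lerD ?ler_wpM2l//.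
by rewrite -mulrA ler_wpM2l// ler_wpM2l// lerD.
Qed.

Lemma ae_weaken (R : realType) (D p q : R -> Prop) : (forall t, p t -> q t) ->
  {ae (@lebesgue_measure R), forall t, D t -> p t} ->
  {ae (@lebesgue_measure R), forall t, D t -> q t}.
Proof.
move=> pq [Z [mZ Z0 pZ]]; exists Z; split=> // t /= nq; apply: pZ => /= pt.
by apply: nq => /pt; exact: pq.
Qed.

Section NegativeMean.
Variable R : realType.
Local Notation mu := (@lebesgue_measure R).
Variables (A B : R -> R) (m : R).
Hypotheses (A_cont : continuous A) (B_cont : continuous B).
Hypotheses (A1 : forall t, A (t + 1) = A t) (B1 : forall t, B (t + 1) = B t).
Hypotheses (m_gt0 : 0 < m) (mA : forall t, m <= A t) (B_ge0 : forall t, 0 <= B t).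

(* The value x at the zeros of B is -oo for phi, whose poles are sent to -oo,
   and +oo for - phi. *)
Definition log_ratio (x : \bar R) (t : R) : \bar R :=
  if B t == 0 then x else (ln (A t) - ln (B t))%:E.

(** Adding e > 0 removes the singularities at the zeros of [B] and only lowers the function
    elsewhere. *)
Definition log_ratio_approx (e t : R) : R := ln (A t) - ln (B t + e).

Lemma log_ratio_approx_continuous e : 0 < e -> continuous (log_ratio_approx e).
Proof.
move=> e0 t; apply: cvgB.
  apply: continuous_comp; first exact: A_cont.
  by apply: continuous_ln; exact: lt_le_trans (mA t).
apply: (@continuous_comp _ _ _ (fun t => B t + e) (@ln R)).
  by apply: cvgD; [exact: B_cont|exact: cvg_cst].
by apply: continuous_ln; rewrite ltr_wpDl.
Qed.

Lemma measurable_log_ratio (x : \bar R) :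
  measurable_fun (`[0%R, 1%R]%classic : set R) (log_ratio x).
Proof.
have mC (f : R -> R) : continuous f -> measurable_fun setT f.
  exact: continuous_measurable_fun.
apply: measurable_funTS; apply: measurable_fun_ifT.
- apply: measurable_fun_eqr; [exact: mC|exact: measurable_cst].
- exact: measurable_cst.
- apply/measurable_EFinP; apply: measurable_funB.
    by apply: measurableT_comp; [exact: measurable_ln|exact: mC].
  by apply: measurableT_comp; [exact: measurable_ln|exact: mC].
Qed.

(** The inequality holds pointwise off the null set of zeros of [B]. As [log_ratio] is not known to
    be integrable, positive and negative parts are compared separately. *)
Lemma log_ratio_approx_integral_le (e : R) (x : \bar R) : 0 < e ->
  {ae mu, forall t, `[0, 1]%classic t -> B t != 0} ->
  ((\int[mu]_(t in `[0%R, 1%R]) log_ratio_approx e t)%R%:E <=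
   \int[mu]_(t in `[0%R, 1%R]) log_ratio x t)%E.
Proof.
move=> e0 B0.
have cphi := log_ratio_approx_continuous e0.
have le t : B t != 0 -> ((log_ratio_approx e t)%:E <= log_ratio x t)%E.
  move=> Bt; rewrite /log_ratio (negbTE Bt) lee_fin lerD2l lerN2.
  have B_gt0 : 0 < B t by rewrite lt_neqAle B_ge0 eq_sym Bt.
  by rewrite ler_ln ?posrE ?addr_gt0// lerDl ltW.
have mphi : measurable_fun (`[0%R, 1%R]%classic : set R)
    (fun t => (log_ratio_approx e t)%:E).
  apply/measurable_EFinP; apply: measurable_funTS; exact: continuous_measurable_fun.
rewrite /Rintegral fineK; last first.
  by apply: integrable_fin_num => //; exact: continuous_integrable_itv.
rewrite integralE [leRHS]integralE; apply: leeB; apply: ae_ge0_le_integral => //.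
- exact: measurable_funepos.
- exact: measurable_funepos (measurable_log_ratio x).
- apply: ae_weaken B0 => t /le h.
  by rewrite !funeposE ge_max le_max h /= le_max lexx orbT.
- exact: measurable_funeneg (measurable_log_ratio x).
- exact: measurable_funeneg.
- apply: ae_weaken B0 => t /le h.
  by rewrite !funenegE ge_max le_max leeN2 h /= le_max lexx orbT.
Qed.

(* The rotation preserves the integral, so the Birkhoff sums of the continuous
   function [ln A - ln (B + e)] are very negative somewhere. For e small, in
   terms of M, replacing B + e by B costs at most the factor 2. *)
Lemma exists_contracting_orbit (theta : R) (x : \bar R) :
  {ae mu, forall t, `[0, 1]%classic t -> B t != 0} ->
  (\int[mu]_(t in `[0%R, 1%R]) log_ratio x t < 0)%E ->
  exists2 c : R, 0 < c & forall M : nat, exists t : R,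
    \prod_(j < M) A (t + j%:R * theta) <=
      2 * expR (- (c * M%:R)) * \prod_(j < M) B (t + j%:R * theta).
Proof.
move=> B0 Fneg.
(* The slack between 2c and c allows the contradiction below to be drawn from non-strict
   inequalities between integrals. For the integral -oo any c works. *)
have [c c0 Fc] : exists2 c : R, 0 < c &
    (\int[mu]_(t in `[0%R, 1%R]) log_ratio x t <= (- (c *+ 2))%:E)%E.
  case: (\int[mu]_(t in _) _)%E Fneg => [r|//|_]; last by exists 1; rewrite ?leNye.
  rewrite lte_fin => r0; exists (- r / 2); first by rewrite divr_gt0// oppr_gt0.
  by rewrite lee_fin; lra.
exists c => // M.
have [C C0 BC] : exists2 C, 0 <= C & forall t, 0 <= B t <= C.
  have [t0 [t1 Bt]] := periodic_extrema B_cont B1; exists (B t1) => // t.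
  by rewrite B_ge0; case/andP: (Bt t).
have [K K0 KP] := prod_add_le M C0.
(* The choice gives e K <= m^M / 2, which is at most half of the product of the values of [A], as
   each of them is at least m. *)
pose e : R := Num.min 1 (m ^+ M / (2 * (K + 1))).
have mM0 : 0 < m ^+ M by rewrite exprn_gt0.
have K1 : 0 < 2 * (K + 1) by rewrite mulr_gt0// ltr_wpDl.
have e0 : 0 < e by rewrite lt_min ltr01 divr_gt0.
have e1 : e <= 1 by rewrite ge_min lexx.
have eK : e * K <= m ^+ M / 2.
  have : e <= m ^+ M / (2 * (K + 1)) by rewrite ge_min lexx orbT.
  rewrite ler_pdivlMr// => h; rewrite ler_pdivlMr//; apply: le_trans h.
  by rewrite -mulrA ler_wpM2l ?(ltW e0)//; lra.
pose phi := log_ratio_approx e; have cphi := log_ratio_approx_continuous e0.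
have phi1 t : phi (t + 1) = phi t by rewrite /phi /log_ratio_approx A1 B1.
have Aphi t : A t = expR (phi t) * (B t + e).
  have Be : 0 < B t + e by rewrite ltr_wpDl.
  by rewrite expRD expRN !lnK ?posrE// ?(lt_le_trans m_gt0)// divfK// gt_eqF.
have cphiD s : continuous (fun t => phi (t + s)).
  move=> t; apply: (@continuous_comp _ _ _ (fun t => t + s) phi); last exact: cphi.
  by apply: cvgD; [exact: cvg_id|exact: cvg_cst].
have SE n : (fun t => \sum_(j < n.+1) phi (t + j%:R * theta)) =
    (fun t => \sum_(j < n) phi (t + j%:R * theta) + phi (t + n%:R * theta)).
  by apply/funext => t; rewrite big_ord_recr.
have cS n : continuous (fun t => \sum_(j < n) phi (t + j%:R * theta)).
  elim: n => [|n IHn] t; first by under eq_fun do rewrite big_ord0; exact: cvg_cst.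
  by rewrite SE; apply: cvgD; [exact: IHn|exact: cphiD].
have [t tS] : exists t, \sum_(j < M) phi (t + j%:R * theta) <= - (c * M%:R).
  have intS n : \int[mu]_(t in `[0, 1]) (\sum_(j < n) phi (t + j%:R * theta)) =
      n%:R * \int[mu]_(t in `[0, 1]) phi t.
    elim: n => [|n IHn].
      by under eq_Rintegral do rewrite big_ord0; rewrite Rintegral_cst// !mul0r.
    rewrite SE RintegralD//.
    - by rewrite IHn Rintegral_rotation// -natr1 mulrDl mul1r.
    - exact: (continuous_integrable_itv 0 1 (cS n)).
    - exact: (continuous_integrable_itv 0 1 (cphiD _)).
  have intphi : \int[mu]_(t in `[0, 1]) phi t <= - (c *+ 2).
    by rewrite -lee_fin (le_trans _ Fc)// log_ratio_approx_integral_le.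
  apply: contrapT => /forallNP h.
  have hS t : - (c * M%:R) <= \sum_(j < M) phi (t + j%:R * theta).
    by move: (h t) => /negP; rewrite -ltNge => /ltW.
  have : \int[mu]_(t in `[0, 1]) (- (c * M%:R)) <=
         \int[mu]_(t in `[0, 1]) (\sum_(j < M) phi (t + j%:R * theta)).
    have mS := continuous_integrable_itv 0 1 (cS M).
    have mc : mu.-integrable `[0, 1] (EFin \o fun=> - (c * M%:R)).
      by apply: continuous_integrable_itv => t; exact: cvg_cst.
    apply: le_Rintegral mc mS _ => // t _; exact: hS.
  have mu01 : fine (mu `[0%R, 1%R]%classic) = 1.
    by rewrite lebesgue_measure_itv /= lte_fin ltr01 oppr0 adde0.
  rewrite Rintegral_cst// intS [fine _]mu01 mulr1 => hM.
  have M0 : 0 < M%:R :> R.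
    rewrite ltr0n lt0n; apply/eqP => M0.
    by apply: (h 0); rewrite M0 big_ord0 mulr0 oppr0.
  have := le_trans hM (ler_wpM2l (ltW M0) intphi).
  rewrite mulrC -mulrN ler_pM2l//; lra.
exists t.
have AE : \prod_(j < M) A (t + j%:R * theta) =
    expR (\sum_(j < M) phi (t + j%:R * theta)) * \prod_(j < M) (B (t + j%:R * theta) + e).
  rewrite expR_sum -big_split /=; apply: eq_bigr => j _; exact: Aphi.
have mA' : m ^+ M <= \prod_(j < M) A (t + j%:R * theta).
  rewrite -[X in _ ^+ X]card_ord -prodr_const; apply: ler_prod => j _.
  by rewrite ltW//= mA.
have B'0 : 0 <= \prod_(j < M) (B (t + j%:R * theta) + e).
  by apply: prodr_ge0 => j _; rewrite addr_ge0// ltW.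
have E1 : expR (- (c * M%:R)) <= 1.
  by rewrite -expR0 ler_expR oppr_le0 mulr_ge0// ltW.
have := KP (fun j => B (t + j%:R * theta)) e _ (fun j => BC _).
rewrite (ltW e0) e1 => /(_ isT) KPe.
have : \prod_(j < M) A (t + j%:R * theta) <=
    expR (- (c * M%:R)) * (\prod_(j < M) B (t + j%:R * theta) + e * K).
  rewrite AE ler_pM ?expR_ge0// ler_expR//.
rewrite mulrDr => h.
(* The error term is at most half of the product of the values of [A]; moving it to the left
   produces the factor 2. *)
have : expR (- (c * M%:R)) * (e * K) <= m ^+ M / 2.
  by apply: le_trans eK; rewrite ler_piMl// mulr_ge0// ltW.
rewrite -mulrA; lra.
Qed.

End NegativeMean.

(** * The circle parametrised by t |-> exp(2 pi i t) *)

Section CircleParametrisation.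
Variable R : realType.
Local Open Scope complex_scope.
Implicit Types (s t : R) (z chi : R[i]).

Definition cexp t : R[i] := cos (2 * pi * t)%R +i* sin (2 * pi * t)%R.

Lemma cexpD s t : cexp (s + t) = cexp s * cexp t.
Proof.
apply/eqP; rewrite eq_complex /= mulrDr cosD sinD [_ * sin _ + _]addrC eqxx andTb.
by apply/eqP; ring.
Qed.

Lemma cexp0 : cexp 0 = 1.
Proof. by rewrite /cexp mulr0 cos0 sin0. Qed.

Lemma cexp1 : cexp 1 = 1.
Proof. by rewrite /cexp mulr1 mulr_natl cos2pi sin2pi. Qed.

Lemma cabs_cexp t : cabs (cexp t) = 1.
Proof. by rewrite /cabs /= cos2Dsin2 sqrtr1. Qed.

Lemma cexp_neq0 t : cexp t != 0.
Proof. by rewrite -cabs_eq0 cabs_cexp oner_eq0. Qed.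

Lemma cexp_periodic t : cexp (t + 1) = cexp t.
Proof. by rewrite cexpD cexp1 mulr1. Qed.

Lemma cexpMn (n : nat) t : cexp (n%:R * t) = cexp t ^+ n.
Proof.
elim: n => [|n IHn]; first by rewrite mul0r cexp0.
by rewrite -natr1 mulrDl mul1r cexpD IHn exprSr.
Qed.

Lemma cexpN t : cexp (- t) = (cexp t)^-1.
Proof.
by apply: (mulfI (cexp_neq0 t)); rewrite divff ?cexp_neq0// -cexpD subrr cexp0.
Qed.

Lemma cexpMz (n : int) t : cexp (n%:~R * t) = cexp t ^ n.
Proof.
case: n => n; first exact: cexpMn.
by rewrite NegzE mulrNz mulNr cexpN cexpMn.
Qed.

Lemma circleP z : circle z <-> cabs z = 1.
Proof.
split=> [h|h]; first by rewrite /cabs (h : `|z| = 1).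
exact: (congr1 (fun x : R => x%:C) h).
Qed.

Lemma circle_cexp t : circle (cexp t).
Proof. exact/circleP/cabs_cexp. Qed.

Lemma cexp_surj z : circle z -> exists t, z = cexp t.
Proof.
move=> /circleP; case: z => a b; rewrite /cabs /= => h.
have ab : a ^+ 2 + b ^+ 2 = 1.
  by rewrite -[LHS]sqr_sqrtr ?addr_ge0 ?sqr_ge0// h expr1n.
have a1 : -1 <= a <= 1.
  rewrite -ler_norml -(@ler_pXn2r _ 2) ?nnegrE// expr1n real_normK ?num_real//.
  by rewrite -ab lerDl sqr_ge0.
have pi0 : 2 * pi != 0 :> R by rewrite mulf_neq0// gt_eqF// pi_gt0.
have sb : Num.sqrt (1 - a ^+ 2) = `|b| by rewrite -ab addrAC subrr add0r sqrtr_sqr.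
have [b0|b0] := leP 0 b.
  exists (acos a / (2 * pi)); rewrite /cexp mulrC divfK//.
  by rewrite acosK ?in_itv// sin_acos// sb ger0_norm.
exists (- (acos a / (2 * pi))); rewrite /cexp mulrN [2 * pi * _]mulrC divfK//.
by rewrite cosN sinN acosK ?in_itv// sin_acos// sb ltr0_norm// opprK.
Qed.

Definition complex_continuous (G : R -> R[i]) : Prop :=
  continuous (fun t => complex.Re (G t)) /\ continuous (fun t => complex.Im (G t)).

Lemma complex_continuous_cst z : complex_continuous (fun=> z).
Proof. by split=> t; exact: cvg_cst. Qed.

Lemma complex_continuousD F G : complex_continuous F -> complex_continuous G ->
  complex_continuous (fun t => F t + G t).
Proof.
by move=> [F1 F2] [G1 G2]; split=> t;
  [under eq_fun do rewrite ReD|under eq_fun do rewrite ImD]; apply: cvgD;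
  [exact: F1|exact: G1|exact: F2|exact: G2].
Qed.

Lemma complex_continuousM F G : complex_continuous F -> complex_continuous G ->
  complex_continuous (fun t => F t * G t).
Proof.
by move=> [F1 F2] [G1 G2]; split=> t;
  [under eq_fun do rewrite ReM; apply: cvgB|under eq_fun do rewrite ImM; apply: cvgD];
  apply: cvgM; by [exact: F1|exact: F2|exact: G1|exact: G2].
Qed.

Lemma complex_continuous_cexp (r : R) : complex_continuous (fun t => cexp (r * t)).
Proof.
have c : continuous (fun t => 2 * pi * (r * t)).
  by move=> t; apply: cvgMl_tmp; apply: cvgMl_tmp; exact: cvg_id.
split=> t /=; apply: (@continuous_comp _ _ _ (fun t => 2 * pi * (r * t)));
  by [exact: c|exact: continuous_cos|exact: continuous_sin].
Qed.

Lemma continuous_cabs G : complex_continuous G -> continuous (fun t => cabs (G t)).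
Proof.
have cabsE z : cabs z = Num.sqrt (complex.Re z ^+ 2 + complex.Im z ^+ 2) by case: z.
move=> [G1 G2] t; under eq_fun do rewrite cabsE.
apply: (@continuous_comp _ _ _ (fun t => complex.Re (G t) ^+ 2 + complex.Im (G t) ^+ 2)).
  by apply: cvgD; apply: cvgM; by [exact: G1|exact: G2].
exact: sqrt_continuous.
Qed.

Definition lcirc (g : laurent) chi t : R[i] := lpoly_eval g (cexp t) chi.

Lemma lcirc_periodic g chi t : lcirc g chi (t + 1) = lcirc g chi t.
Proof. by rewrite /lcirc cexp_periodic. Qed.

Lemma complex_continuous_lcirc g chi : complex_continuous (lcirc g chi).
Proof.
rewrite /lcirc /lpoly_eval; elim: (enum_fset _) => [|k r IHr].
  by under eq_fun do rewrite big_nil; exact: complex_continuous_cst.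
under eq_fun do rewrite big_cons.
apply: complex_continuousD => //.
apply: complex_continuousM; last exact: complex_continuous_cst.
apply: complex_continuousM; first exact: complex_continuous_cst.
under eq_fun do rewrite -cexpMz; exact: complex_continuous_cexp.
Qed.
End CircleParametrisation.

(** * Zeros on the circle form a null set *)

Section ZeroSet.
Variable R : realType.
Local Notation mu := (@lebesgue_measure R).

(** Multiplication by a^N, with [N] bounding all |k.1|, clears the negative powers of a. What
    remains is a polynomial, nonzero because of [a1], with finitely many roots. *)
Lemma lpoly_eval_finite_zeros (F : closedFieldType) (g : laurent) (a1 b : F) :
  a1 != 0 -> lpoly_eval g a1 b != 0 ->
  exists r : seq F, forall a, a != 0 -> lpoly_eval g a b = 0 -> a \in r.
Proof.
move=> a1_neq0 ga1.
pose N := (\sum_(k <- gsupp g) `|k.1|)%N.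
pose p : {poly F} := \sum_(k <- gsupp g)
  ((gcoef k g)%:~R * b ^ k.2) *: 'X^(`|k.1 + N%:Z|).
have kN (k : int * int) : k \in gsupp g -> 0 <= k.1 + N%:Z.
  move=> kg; have : (`|k.1| <= N)%N.
    by rewrite /N (bigD1_seq k kg (fset_uniq _)); exact: leq_addr.
  lia.
have pE a : a != 0 -> p.[a] = a ^+ N * lpoly_eval g a b.
  move=> a0; rewrite /p horner_sum /lpoly_eval mulr_sumr.
  rewrite big_seq_cond [RHS]big_seq_cond; apply: eq_bigr => k; rewrite andbT => /kN k0.
  rewrite hornerZ hornerXn exprnP gez0_abs// expfzDr// -exprnP.
  ring.
have p_neq0 : p != 0.
  apply: contraNneq ga1 => p0; have := pE _ a1_neq0; rewrite p0 horner0 => /esym/eqP.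
  by rewrite mulf_eq0 expf_eq0 (negbTE a1_neq0) andbF.
have [r pr] := closed_field_poly_normal p.
exists r => a a0 ga; rewrite -root_prod_XsubC.
have : root p a by rewrite /root pE// ga mulr0.
by rewrite pr rootZ// lead_coef_eq0.
Qed.

Lemma cexp_fiber (t : R) : 0 <= t <= 1 ->
  t = acos (complex.Re (cexp t)) / (2 * pi) \/
  t = 1 - acos (complex.Re (cexp t)) / (2 * pi).
Proof.
move=> /andP[t0 t1] /=.
have p0 : 0 < 2 * pi :> R by rewrite mulr_gt0// pi_gt0.
have pn0 : 2 * pi != 0 :> R by rewrite gt_eqF.
have [th|th] := leP (2 * t) 1; [left|right].
  rewrite cosK; first by rewrite [2 * pi * t]mulrC mulfK.
  rewrite in_itv /= mulr_ge0 ?(ltW p0)//= mulrAC ler_piMl ?pi_ge0//.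
have -> : cos (2 * pi * t) = cos (2 * pi * (1 - t)).
  by rewrite mulrBr mulr1 mulr_natl addrC cosD2pi cosN.
rewrite cosK; first by rewrite [2 * pi * _]mulrC mulfK// subKr.
rewrite in_itv /= mulr_ge0 ?(ltW p0) ?subr_ge0//= mulrAC ler_piMl ?pi_ge0//; lra.
Qed.

(** There are finitely many zeros on the circle, and by [cexp_fiber] each comes from at most two
    parameters in [0, 1]. *)
Lemma lcirc_ae_neq0 (g : laurent) (chi : R[i]) (s : R) :
  (exists2 zeta, circle zeta & lpoly_eval g zeta chi != 0) ->
  {ae mu, forall t, `[0, 1]%classic t -> lcirc g chi (t - s) != 0}.
Proof.
move=> [_ /cexp_surj[t1 ->] /(lpoly_eval_finite_zeros (cexp_neq0 t1))[r rP]].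
pose ac (z : R[i]) : R := acos (complex.Re z) / (2 * pi).
pose r' := map (fun z => z * cexp s) r.
pose ts := map ac r' ++ map (fun z => 1 - ac z) r'.
apply: (@negligibleS _ _ _ mu [set` ts]).
  move=> t /= /not_implyP[t01 /negP/negPn/eqP gt].
  have tr : cexp t \in r'.
    apply/mapP; exists (cexp (t - s)); first exact: rP (cexp_neq0 _) gt.
    by rewrite -cexpD subrK.
  rewrite mem_cat; move: t01; rewrite in_itv /= => /cexp_fiber[|] tE.
    by apply/orP; left; apply/mapP; exists (cexp t).
  by apply/orP; right; apply/mapP; exists (cexp t).
have cs : countable [set` ts] by apply: finite_set_countable; exact: finite_seq.
apply/negligibleP; last exact: countable_lebesgue_measure0.
exact: countable_measurable.
Qed.
End ZeroSet.

(** * Normalised windows along an orbit of the rotation *)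

Section NormalisedWindows.
Variables (R : realType) (P Q : R -> R[i]) (theta : R) (x : \bar R).
Hypotheses (P_cont : complex_continuous P) (Q_cont : complex_continuous Q).
Hypotheses (P1 : forall t, P (t + 1) = P t) (Q1 : forall t, Q (t + 1) = Q t).
Hypothesis theta_irr : forall n, (0 < n)%N -> n%:R * theta \isn't a Num.int.
Hypothesis P_neq0 : forall t, P t != 0.
Hypothesis Q_zero : exists t, Q t = 0.

Local Notation A := (fun t => cabs (P t)).
Local Notation B := (fun t => cabs (Q (t - theta))).

Hypothesis Q_ae : {ae (@lebesgue_measure R), forall t,
  `[0, 1]%classic t -> Q (t - theta) != 0}.
Hypothesis mean_lt0 :
  (\int[@lebesgue_measure R]_(t in `[0%R, 1%R]) log_ratio A B x t < 0)%E.

(** Take a long orbit segment on which the product of |P| is far below that of [B]. Within [N0]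
    steps it enters an arc where [B] is small; restarting there loses a factor bounded independently
    of the length, and [window_solution] applies. *)
Lemma exists_normalised_window (N : nat) : exists (t : R) (u : int -> R[i]),
  [/\ u 0 = 1, forall a, (`|a| <= N)%N -> cabs (u a) <= 1 &
    forall a : int, - N%:Z <= a < N%:Z ->
      Q (t + a%:~R * theta) * u (a + 1) = P (t + a%:~R * theta) * u a].
Proof.
have A_cont := continuous_cabs P_cont.
have cQ := continuous_cabs Q_cont.
have B_cont : continuous B.
  move=> t; apply: (@continuous_comp _ _ _ (fun t => t - theta) (fun t => cabs (Q t))).
    by apply: cvgB; [exact: cvg_id|exact: cvg_cst].
  exact: cQ.
have A1 t : A (t + 1) = A t by rewrite /= P1.
have cQ1 t : cabs (Q (t + 1)) = cabs (Q t) by rewrite Q1.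
have B1 t : B (t + 1) = B t by rewrite /= addrAC Q1.
have B_ae : {ae (@lebesgue_measure R), forall t, `[0, 1]%classic t -> B t != 0}.
  by apply: ae_weaken Q_ae => t; rewrite cabs_eq0.
have [tm [tm' Am]] := periodic_extrema A_cont A1.
have [tM0 [tM BM]] := periodic_extrema cQ cQ1.
pose m := A tm; pose C := Num.max m (cabs (Q tM)).
have m0 : 0 < m by exact/cabs_gt0/P_neq0.
have mA t : m <= A t by case/andP: (Am t).
have BC t : cabs (Q t) <= C by rewrite le_max; case/andP: (BM t) => _ ->; rewrite orbT.
have mC : m <= C by rewrite le_max lexx.
have Cm1 : 1 <= C / m by rewrite ler_pdivlMr// mul1r.
have Cm0 n : 0 < (C / m) ^+ n by rewrite exprn_gt0// (lt_le_trans ltr01).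
have B_ge0 t : 0 <= B t by exact: cabs_ge0.
have [c c0 cP] :=
  exists_contracting_orbit A_cont B_cont A1 B1 m0 mA B_ge0 theta B_ae mean_lt0.
have [t0 Qt0] := Q_zero.
(* [B] vanishes at t0 + theta. Since [B] at the starting point will be the modulus of [q (-1)], the
   arc is cut to the smallness condition of [window_solution]. *)
have [d d0 dB] : exists2 d : R, 0 < d &
    forall s, `|s - (t0 + theta)| < d -> B s * (C / m) ^+ N <= m.
  have Bt0 : B s @[s --> t0 + theta] --> (0 : R).
    by have := B_cont (t0 + theta); rewrite /continuous_at addrK Qt0 cabs0.
  have e0 : 0 < m / (C / m) ^+ N by rewrite divr_gt0.
  have /cvgrPdist_lt/(_ _ e0)/nbhs_ballP[d /= d0 dB] := Bt0.
  exists d => // s sd; rewrite -ler_pdivlMr//.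
  have := dB s; rewrite /ball /= distrC => /(_ sd).
  by rewrite sub0r normrN ger0_norm// => /ltW.
have [N0 N0P] := irrational_rotation_dense theta_irr d0.
(* [D] bounds all losses for every j <= N0, and exp(c M) >= 1 + c M > D by the choice of [M]. The
   summand [N0] ensures j <= M. *)
pose D := 2 * (C / m) ^+ (N0 + N.+1).
have D0 : 0 < D by rewrite mulr_gt0.
pose M := (N0 + (Num.truncn (D / c)).+1)%N.
have [t tP] := cP M.
have [j [k [jN0 jk]]] := N0P t (t0 + theta).
pose t' := t + j%:R * theta.
have [M' MM'] : exists M', (M = j + M')%N.
  by exists (M - j)%N; rewrite subnKC// (leq_trans jN0)// leq_addr.
have Bt' : B t' * (C / m) ^+ N <= m.
  have := dB (t' - k%:~R).
  rewrite -/t' in jk; rewrite addrAC in jk => /(_ jk).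
  have -> : t' - k%:~R - theta = t' - theta + (- k)%:~R by rewrite mulrNz addrAC.
  by rewrite (periodic_intr Q1).
(* The ratio B / A is at most C / m, so that dropping the first j steps of the
   orbit costs at most the factor (C / m) ^+ j. *)
pose e := 2 * expR (- (c * M%:R)) * (C / m) ^+ j.
have e1 : e * (C / m) ^+ N.+1 < 1.
  have : D < expR (c * M%:R).
    apply: lt_le_trans (expR_ge1Dx _).
    have : D < (Num.truncn (D / c)).+1%:R * c by rewrite -ltr_pdivrMr// truncnS_gt.
    have : 0 <= c * N0%:R by rewrite mulr_ge0// ltW.
    rewrite /M natrD mulrDr; lra.
  rewrite -(ltr_pM2r (expR_gt0 (- (c * M%:R)))) -expRD subrr expR0.
  apply: le_lt_trans; rewrite /e /D -!mulrA ler_wpM2l// -exprD.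
  rewrite [X in _ <= X]mulrC ler_wpM2l ?expR_ge0//.
  by rewrite ler_weXn2l// leq_add2r.
have sE (i : nat) : t' + i%:R * theta = t + (j + i)%:R * theta.
  by rewrite natrD mulrDl addrA.
have tP' : \prod_(i < M') cabs (P (t' + i%:R * theta)) <=
    e * \prod_(i < M') B (t' + i%:R * theta).
  move: tP; rewrite /e; move: (expR _) (expR_ge0 (- (c * M%:R))) => E E0.
  rewrite MM' !big_split_ord /=.
  under [X in _ * X <= _]eq_bigr => i _ do rewrite -sE.
  under [X in _ <= _ * (_ * X)]eq_bigr => i _ do rewrite -sE.
  set X2 := \prod_(i < M') _; set Y2 := \prod_(i < M') _ => h.
  have X2_ge0 : 0 <= X2 by apply: prodr_ge0 => i _; exact: cabs_ge0.
  have Y2_ge0 : 0 <= Y2 by apply: prodr_ge0 => i _; exact: cabs_ge0.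
  rewrite expr_div_n mulrA mulrAC ler_pdivlMr ?exprn_gt0// mulrC.
  apply: le_trans (_ : _ <= 2 * E * (C ^+ j * Y2)) _; last by rewrite !mulrA.
  apply: (@le_trans _ _ (\prod_(i < j) cabs (P (t + i%:R * theta)) * X2)).
    rewrite ler_wpM2r// -[X in m ^+ X]card_ord -prodr_const; apply: ler_prod => i _.
    by rewrite mA ltW.
  apply: le_trans h _; rewrite ler_wpM2l ?mulr_ge0// ler_wpM2r//.
  rewrite -[X in C ^+ X]card_ord -prodr_const; apply: ler_prod => i _.
  by rewrite cabs_ge0 BC.
pose p (a : int) := P (t' + a%:~R * theta).
pose q (a : int) := Q (t' + a%:~R * theta).
have [s [u [u0 u1 uE]]] : exists (s : nat) (u : int -> R[i]), [/\ u 0 = 1,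
    forall a, (`|a| <= N)%N -> cabs (u a) <= 1 &
    forall a, - N%:Z <= a < N%:Z -> q (s%:Z + a) * u (a + 1) = p (s%:Z + a) * u a].
  apply: (@window_solution R p q m C _ _ _ _ N M' e) => //.
  - by move=> a; exact: mA.
  - by move=> a; exact: BC.
  - by rewrite /q rmorphN1 mulN1r.
  - apply: le_trans tP' _; rewrite le_eqVlt; apply/orP; left; apply/eqP.
    congr (_ * _); apply: eq_bigr => i _; rewrite /q intrB mulrBl mul1r.
    by rewrite addrA.
exists (t' + s%:R * theta), u; split=> // a /uE.
by rewrite /p /q intrD mulrDl addrA.
Qed.
End NormalisedWindows.

(** * Linear forms on group rings and coordinates on the Heisenberg group *)

Section Pairing.
Variables (G : groupType) (K : pzRingType).
Implicit Types (F : G -> K) (u v : group_ring G).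

(** The additive extension of [F] to the group ring. Applied to a left translate of a function on
    the group, its vanishing is the equation of the kernel at one group element. *)
Definition pairing F u : K := \sum_(a <- gsupp u) (gcoef a u)%:~R * F a.

Lemma pairing_wide F u (d : {fset G}) : (gsupp u `<=` d)%fset ->
  pairing F u = \sum_(a <- d) (gcoef a u)%:~R * F a.
Proof.
move=> ud; rewrite /pairing (big_fset_incl _ ud) //= => a _ /monalg.mcoeff_outdom ->.
by rewrite mul0r.
Qed.

Lemma pairingB F u v : pairing F (u - v) = pairing F u - pairing F v.
Proof.
pose d : {fset G} := (gsupp (u - v) `|` (gsupp u `|` gsupp v))%fset.
have du : (gsupp u `<=` d)%fset by apply: fsubset_trans (fsubsetUr _ _); exact: fsubsetUl.
have dv : (gsupp v `<=` d)%fset by apply: fsubset_trans (fsubsetUr _ _); exact: fsubsetUr.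
rewrite (@pairing_wide F (u - v) d) ?fsubsetUl// (pairing_wide F du) (pairing_wide F dv).
rewrite -sumrB; apply: eq_bigr => a _.
by rewrite monalg.mcoeffB intrB mulrBl.
Qed.

Lemma pairing0 F : pairing F 0 = 0.
Proof. by rewrite /pairing monalg.msupp0 big_seq_fset0. Qed.

Lemma pairing_sum F (I : Type) (r : seq I) (U : I -> group_ring G) :
  pairing F (\sum_(i <- r) U i) = \sum_(i <- r) pairing F (U i).
Proof.
apply: big_morph => [u v|]; last exact: pairing0.
have N w : pairing F (- w) = - pairing F w by rewrite -[- w]sub0r pairingB pairing0 sub0r.
by rewrite -{1}[v]opprK pairingB N opprK.
Qed.

Lemma pairing_gmono F a c : pairing F (gmono a c) = c%:~R * F a.
Proof.
rewrite (@pairing_wide F _ [fset a]%fset) ?monalg.msuppU_le//.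
by rewrite big_seq_fset1 monalg.mcoeffUU.
Qed.

End Pairing.

(* heis_of a b c = y^b z^c x^a *)
Definition heis_of (a b c : int) : heis := Heis (hmx_unitri a b c).

Lemma heis_ofP (h : heis) : exists a b c, h = heis_of a b c.
Proof.
case: h => A hA; have /unitriP[a [b [c AE]]] := hA.
by exists a, b, c; apply: val_inj.
Qed.

Lemma heis_ofM a b c a' b' c' :
  (heis_of a b c * heis_of a' b' c')%g =
  heis_of (a + a') (b + b') (c + c' + a * b').
Proof. by apply: val_inj => /=; rewrite hmxM. Qed.

Lemma heis_of1 : 1%g = heis_of 0 0 0.
Proof. by apply: val_inj; rewrite /= hmx1. Qed.

(** With first coordinate 0 the twist a b' in the product vanishes, so powers are computed
    coordinatewise. *)
Lemma gexpz_central (b c m : int) :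
  gexpz (heis_of 0 b c) m = heis_of 0 (m * b) (m * c).
Proof.
have E (n : nat) : (heis_of 0 b c ^+ n)%g = heis_of 0 (n%:Z * b) (n%:Z * c).
  elim: n => [|n IHn]; first by rewrite expg0 heis_of1 !mul0r.
  by rewrite expgS IHn heis_ofM; congr heis_of; lia.
case: m => n; first exact: E.
rewrite /gexpz E; apply: (mulgI (heis_of 0 (n.+1%:Z * b) (n.+1%:Z * c))).
by rewrite mulgV heis_ofM heis_of1 NegzE; congr heis_of; lia.
Qed.

Lemma heis_yz (k : int * int) : (gexpz hy k.1 * gexpz hz k.2)%g = heis_of 0 k.1 k.2.
Proof.
rewrite hzE -[hy]/(heis_of 0 1 0) -[Heis _]/(heis_of 0 0 1) !gexpz_central heis_ofM.
by congr heis_of; lia.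
Qed.

(** * From the recurrence to solutions on the Heisenberg group *)

Section HeisenbergKernel.
Variables (K : fieldType) (zeta chi : K) (u : int -> K).
Hypotheses (zeta_neq0 : zeta != 0) (chi_neq0 : chi != 0).

Definition heis_wave (h : heis) : K :=
  chi ^ (heis_val h 0 (inord 2)) * zeta ^ (heis_val h (inord 1) (inord 2)) *
  u (heis_val h 0 (inord 1)).

Lemma heis_waveE a b c : heis_wave (heis_of a b c) = chi ^ c * zeta ^ b * u a.
Proof. by rewrite /heis_wave /= !mxE /= !inordK. Qed.

(** Right multiplication of [heis_of a b c] by y^k adds k to [b] and, by noncommutativity, a k to
    [c]. So y acts as multiplication by zeta chi^a, which is how the rotation by chi enters. *)
Lemma pairing_lpoly_yz (g : laurent) (a b c : int) :
  pairing (fun h => heis_wave (heis_of a b c * h)%g) (lpoly_yz g) =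
  chi ^ c * zeta ^ b * (lpoly_eval g (zeta * chi ^ a) chi * u a).
Proof.
rewrite pairing_sum mulr_suml mulr_sumr; apply: eq_bigr => k _.
rewrite pairing_gmono heis_yz heis_ofM heis_waveE addr0 !expfzDr// expfzMl -exprz_exp.
ring.
Qed.

Lemma pairing_lpoly_yz_gx (g : laurent) (a b c : int) :
  pairing (fun h => heis_wave (heis_of a b c * h)%g) (lpoly_yz g * gx) =
  chi ^ c * zeta ^ b * (lpoly_eval g (zeta * chi ^ a) chi * u (a + 1)).
Proof.
rewrite mulr_suml pairing_sum mulr_suml mulr_sumr; apply: eq_bigr => k _.
rewrite [X in pairing _ X]gr_mulUU mulr1 pairing_gmono heis_yz -[hx]/(heis_of 1 0 0).
rewrite !heis_ofM (_ : heis_of _ _ _ = heis_of (a + 1) (b + k.1) (c + k.2 + a * k.1)).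
  by rewrite heis_waveE !expfzDr// expfzMl -exprz_exp; ring.
by congr heis_of; ring.
Qed.

Lemma heis_wave_kernel (g0 g1 : laurent) (a b c : int) :
  lpoly_eval g1 (zeta * chi ^ a) chi * u (a + 1) =
    lpoly_eval g0 (zeta * chi ^ a) chi * u a ->
  pairing (fun h => heis_wave (heis_of a b c * h)%g) (lpoly_yz g1 * gx - lpoly_yz g0) = 0.
Proof. by move=> ua; rewrite pairingB pairing_lpoly_yz_gx pairing_lpoly_yz ua subrr. Qed.
End HeisenbergKernel.

Lemma cabs_cexp_exp (R : realType) (t : R) (n : int) : cabs (cexp t ^ n) = 1.
Proof. by rewrite -cexpMz cabs_cexp. Qed.

Lemma Re_pairing (R : realType) (G : groupType) (F : G -> R[i]) (v : group_ring G) :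
  complex.Re (pairing F v) = pairing (fun h => complex.Re (F h)) v.
Proof.
rewrite /pairing (big_morph _ (@ReD R) (erefl : complex.Re (0 : R[i]) = 0)).
apply: eq_bigr => a _.
rewrite -(rmorph_int (real_complex R)).
by case: (F a) => ? ? /=; rewrite mul0r subr0.
Qed.

(** Coefficients of [f] are integers, so real parts of solutions are solutions. The equation at
    [heis_of a b c] involves only u_a and u_(a+1), so every large window satisfies it and the limit
    of the windows is a bounded solution. *)
Lemma not_expansive_of_windows (R : realType) (g0 g1 : laurent)
    (f : group_ring heis) (d : principal_group R f -> principal_group R f -> R)
    (theta : R) :
  f = lpoly_yz g1 * gx - lpoly_yz g0 -> compatible_metric d ->
  (forall N : nat, exists (t : R) (u : int -> R[i]),
    [/\ u 0 = 1, forall a, (`|a| <= N)%N -> cabs (u a) <= 1 &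
    forall a : int, - N%:Z <= a < N%:Z ->
      lcirc g1 (cexp theta) (t + a%:~R * theta) * u (a + 1) =
      lcirc g0 (cexp theta) (t + a%:~R * theta) * u a]) ->
  ~ expansive d (@principal_action R heis f).
Proof.
move=> fE cd win.
have /choice[t /choice[u tu]] := win.
pose w N (h : heis) := complex.Re (heis_wave (cexp (t N)) (cexp theta) (u N) h).
have [w' [w'1 w'11 w'f]] : exists w' : heis -> R, [/\ forall a, `|w' a| <= 1, w' 1%g = 1 &
    forall b, \sum_(a <- gsupp f) (gcoef a f)%:~R * w' (b * a)%g = 0].
  apply: (@kernel_of_approximations _ _ _ w).
  - move=> h; have [a [b [c ->]]] := heis_ofP h.
    exists `|a|%N => // N /= aN; have [_ u1 _] := tu N.
    rewrite (le_trans (Re_le_cabs _))// heis_waveE !cabsM !cabs_cexp_exp !mul1r.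
    exact: u1.
  - move=> N; have [u0 _ _] := tu N.
    by rewrite /w heis_of1 heis_waveE !expr0z u0 !mulr1.
  - move=> h; have [a [b [c ->]]] := heis_ofP h.
    (* One more than |a|, since the recurrence is available only for a < N. *)
    exists `|a|.+1 => // N /= aN; have [_ _ uE] := tu N.
    have aN' : - N%:Z <= a < N%:Z by lia.
    have := uE _ aN'; rewrite /lcirc cexpD cexpMz.
    move=> /(heis_wave_kernel (cexp_neq0 (t N)) (cexp_neq0 theta) b c); rewrite -fE.
    by move=> /(congr1 (@complex.Re R)); rewrite Re_pairing.
exact: not_expansive_of_kernel w'1 w'11 w'f.
Qed.

(** * The function phi as a logarithmic ratio *)

Lemma lne_divE (R : realType) (a b : R) : 0 < a -> 0 <= b ->
  lne (a / b)%:E = if b == 0 then -oo%E else (ln a - ln b)%:E.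
Proof.
move=> a0 b0; have [->|b_neq0] := eqVneq b 0; first by rewrite invr0 mulr0 le0_lneNy.
have b_gt0 : 0 < b by rewrite lt_neqAle b0 eq_sym b_neq0.
by rewrite lne_EFin ?divr_gt0// ln_div.
Qed.

Lemma oppe_lne_divE (R : realType) (a b : R) : 0 < a -> 0 <= b ->
  (- lne (b / a)%:E)%E = if b == 0 then +oo%E else (ln a - ln b)%:E.
Proof.
move=> a0 b0; have [->|b_neq0] := eqVneq b 0; first by rewrite mul0r le0_lneNy.
have b_gt0 : 0 < b by rewrite lt_neqAle b0 eq_sym b_neq0.
by rewrite lne_EFin ?divr_gt0// ln_div// -EFinN opprB.
Qed.

Lemma complex_continuous_shift (R : realType) (G : R -> R[i]) (s : R) :
  complex_continuous G -> complex_continuous (fun t => G (t - s)).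
Proof.
have cs : continuous (fun t => t - s).
  by move=> t; apply: cvgB; [exact: cvg_id|exact: cvg_cst].
by move=> [G1 G2]; split=> t;
  [exact: continuous_comp (cs t) (G1 _)|exact: continuous_comp (cs t) (G2 _)].
Qed.

Lemma circle_integral_cexp (R : realType) (F : R[i] -> \bar R) :
  circle_integral F = (\int[@lebesgue_measure R]_(t in `[0%R, 1%R]) F (cexp t))%E.
Proof. by []. Qed.

Section LogRatio.
Variable R : realType.
Local Notation mu := (@lebesgue_measure R).
Local Open Scope complex_scope.
Variables (g0 g1 : laurent) (theta : R).
Local Notation chi := (cexp theta).
Local Notation F := (fun t : R => phi g0 g1 chi (cexp t)).

Lemma phi_cexp (t : R) : phi g0 g1 chi (cexp t) =
  lne (cabs (lcirc g0 chi t) / cabs (lcirc g1 chi (t - theta)))%:E.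
Proof. by rewrite /phi -/(cabs _) /psi cabsM cabsV /lcirc cexpD cexpN. Qed.

Lemma phi_log_ratio : (forall t, lcirc g0 chi t != 0) ->
  F = log_ratio (fun t => cabs (lcirc g0 chi t))
    (fun t => cabs (lcirc g1 chi (t - theta))) -oo%E.
Proof.
move=> g00; apply/funext => t; rewrite phi_cexp; apply: lne_divE (cabs_ge0 _).
exact/cabs_gt0/g00.
Qed.

Lemma oppe_phi_log_ratio : (forall t, lcirc g1 chi t != 0) ->
  (fun t => - F t)%E = log_ratio (fun t => cabs (lcirc g1 chi (t - theta)))
    (fun t => cabs (lcirc g0 chi t)) +oo%E.
Proof.
move=> g10; apply/funext => t; rewrite phi_cexp; apply: oppe_lne_divE (cabs_ge0 _).
exact/cabs_gt0/g10.
Qed.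

End LogRatio.

(** The sign can be pulled out unless the positive and negative parts both have infinite integral.
    In that case the integral of [F] would be oo - oo, which is -oo by convention and so not
    positive. *)
Lemma integral_oppe_lt0 (R : realType) (F : R -> \bar R) :
  (0 < \int[@lebesgue_measure R]_(t in `[0%R, 1%R]) F t)%E ->
  (\int[@lebesgue_measure R]_(t in `[0%R, 1%R]) (- F t) < 0)%E.
Proof.
move=> F0; rewrite integralN ?oppe_lt0//.
have pos (x : \bar R) (y : \bar R) : (0 <= x -> 0 <= y -> 0 < x - y -> x +? - y)%E.
  by case: x => [a| |]; case: y => [b| |].
by apply: pos; [exact: integral_ge0|exact: integral_ge0|rewrite -integralE].
Qed.

(** * Case (i) directly, case (ii) by time reversal *)

Theorem theorem7p1 (R : realType) (g0 g1 : laurent) (f : group_ring heis)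
    (d : principal_group R f -> principal_group R f -> R) :
  f = lpoly_yz g1 * gx - lpoly_yz g0 ->
  (exists chi : R[i],
    [/\ circle chi,
        infinite_order chi,
        exists2 zeta, circle zeta & lpoly_eval g1 zeta chi != 0
      & [/\ zeros chi g0 = set0, zeros chi g1 !=set0
          & (circle_integral (phi g0 g1 chi) < 0)%E]
        \/ [/\ zeros chi g0 !=set0, zeros chi g1 = set0
             & (0 < circle_integral (phi g0 g1 chi))%E]]) ->
  compatible_metric d -> translation_invariant d ->
  ~ expansive d (@principal_action R heis f).
Proof.
move=> fE [_ [/cexp_surj[theta ->] chi_inf g1_neq0 cases]] cd _.
have theta_irr n : (0 < n)%N -> n%:R * theta \isn't a Num.int.
  move=> /chi_inf; apply: contraNN => /intrP[k nk].
  rewrite -cexpMn nk; apply/eqP.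
  by rewrite -[k%:~R]add0r (periodic_intr (@cexp_periodic R)) cexp0.
have noz g : zeros (cexp theta) g = set0 -> forall t, lcirc g (cexp theta) t != 0.
  move=> gz t; apply/negP => /eqP gt.
  have : zeros (cexp theta) g (cexp t) by split=> //; exact: circle_cexp.
  by rewrite gz.
have zz g : zeros (cexp theta) g !=set0 -> exists t, lcirc g (cexp theta) t = 0.
  by move=> [_ [/cexp_surj[t ->] gt]]; exists t.
apply: (not_expansive_of_windows fE cd) => N.
case: cases => [[/noz g00 /zz g1z]|[/zz g0z /noz g10]] mean.
  rewrite circle_integral_cexp (phi_log_ratio g1 g00) in mean.
  exact: (exists_normalised_window (complex_continuous_lcirc _ _)
    (complex_continuous_lcirc _ _) (@lcirc_periodic R _ _) (@lcirc_periodic R _ _)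
    theta_irr g00 g1z (lcirc_ae_neq0 _ g1_neq0) mean).
(* If g0 vanished on the whole circle, phi would be constantly -oo and its integral could not be
   positive. *)
have g0_neq0 : exists2 zeta, circle zeta & lpoly_eval g0 zeta (cexp theta) != 0.
  apply: contrapT => g00.
  have {}g00 t : lcirc g0 (cexp theta) t = 0.
    apply/eqP/negPn/negP => gt; apply: g00; exists (cexp t) => //; exact: circle_cexp.
  have phiE : (fun t => phi g0 g1 (cexp theta) (cexp t)) = cst -oo%E.
    by apply/funext => t; rewrite phi_cexp g00 cabs0 mul0r le0_lneNy.
  rewrite circle_integral_cexp phiE integral_cst// in mean.
  by move: mean; rewrite ltNge mule_le0_ge0.
(* Time reversal exchanges g0 and g1 and replaces theta by - theta. The shift by theta makes the new
   logarithmic ratio equal to - phi and absorbs the index shift a |-> - a - 1 in the reversed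
   recurrence. *)
pose P t := lcirc g1 (cexp theta) (t - theta).
pose Q t := lcirc g0 (cexp theta) (t - theta).
have PQ_cont g : complex_continuous (fun t => lcirc g (cexp theta) (t - theta)).
  exact: complex_continuous_shift (complex_continuous_lcirc _ _).
have PQ_per g t : lcirc g (cexp theta) (t + 1 - theta) = lcirc g (cexp theta) (t - theta).
  by rewrite addrAC lcirc_periodic.
have Q_zero : exists t, Q t = 0.
  by have [t gt] := g0z; exists (t + theta); rewrite /Q addrK.
have ntheta_irr n : (0 < n)%N -> n%:R * - theta \isn't a Num.int.
  by move=> n0; rewrite mulrN rpredN theta_irr.
have QK t : Q (t - - theta) = lcirc g0 (cexp theta) t by rewrite /Q opprK addrK.
have Q_ae : {ae @lebesgue_measure R, forall t, `[0, 1]%classic t -> Q (t - - theta) != 0}.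
  by apply: ae_weaken (lcirc_ae_neq0 0 g0_neq0) => t; rewrite subr0 QK.
have Qmean : (\int[@lebesgue_measure R]_(t in `[0%R, 1%R])
    log_ratio (fun t => cabs (P t))%R (fun t => cabs (Q (t - - theta)))%R (+oo)%E t
    < 0)%E.
  have QE : (fun t => cabs (lcirc g0 (cexp theta) t)) = (fun t => cabs (Q (t - - theta))).
    by apply/funext => t; exact: (congr1 (@cabs R) (esym (QK t))).
  rewrite circle_integral_cexp in mean.
  have := integral_oppe_lt0 mean; rewrite (oppe_phi_log_ratio g0 g10).
  pose B_mean_lt0 (B : R -> R) := (\int[@lebesgue_measure R]_(t in `[0%R, 1%R])
    log_ratio (fun t => cabs (P t))%R B (+oo)%E t < 0)%E.
  by move=> H; exact: (@eq_ind _ _ B_mean_lt0 H _ QE).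
have [t [u [u0 u1 uE]]] := exists_normalised_window (PQ_cont g1) (PQ_cont g0)
  (PQ_per g1) (PQ_per g0) ntheta_irr (fun t => g10 _) Q_zero Q_ae Qmean N.
exists t, (fun a => u (- a)); split=> [|a aN|a aN].
- by rewrite oppr0.
- by rewrite u1// abszN.
(* The map a |-> - a - 1 preserves the half-open range [-N, N). *)
- have aN' : - N%:Z <= - a - 1 < N%:Z by lia.
  have -> : - (a + 1) = - a - 1 by rewrite opprD.
  have := uE _ aN'; rewrite subrK.
  have -> : t + (- a - 1)%:~R * - theta - theta = t + a%:~R * theta.
    by rewrite intrB mulrNz; ring.
  by move=> ->.
Qed.
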